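(* Let $M$ be an 8-manifold with a Cayley form $\Phi$ and let $T\in\Lambda^3$ be its torsion 3-form, i.e. the 3-form with $\nabla_i\Phi_{abcd}=4\,T_{i[a}{}^{p}\Phi_{|p|bcd]}$, where $\nabla$ is the Levi-Civita connection of the metric $g$ determined by $\Phi$. Then $$\star d\Phi = 2J_3(T),$$ where $J_3:\Lambda^3\to\Lambda^3$ is the operator $$J_3(\gamma)_{ijk}=\tfrac32\,\Phi_{[ij}{}^{pq}\gamma_{k]pq}=\tfrac12\left(\Phi_{ij}{}^{pq}\gamma_{kpq}+\Phi_{jk}{}^{pq}\gamma_{ipq}+\Phi_{ki}{}^{pq}\gamma_{jpq}\right).$$ The operator $J_3$ is invertible, and hence $T$ is completely determined by $d\Phi$.
   Context: A Cayley form ($\mathrm{Spin}(7)$-structure) on an 8-manifold $M$ is a 4-form $\Phi$ which at each point lies in a fixed $\mathrm{GL}(8,\mathbb{R})$-orbit of 4-forms with stabiliser $\mathrm{Spin}(7)$. It determines a Riemannian metric $g$ and an orientation. The conventions are fixed by the identity (all contractions and index raisings with $g$) $$\Phi_{ijkp}\Phi_{abc}{}^{p}= g_{ia}g_{jb}g_{kc}+g_{ib}g_{jc}g_{ka}+g_{ic}g_{ja}g_{kb}-g_{ia}g_{jc}g_{kb}-g_{ic}g_{jb}g_{ka}-g_{ib}g_{ja}g_{kc}$$ $$-g_{ia}\Phi_{jkbc}-g_{ja}\Phi_{kibc}-g_{ka}\Phi_{ijbc}-g_{ib}\Phi_{jkca}-g_{jb}\Phi_{kica}-g_{kb}\Phi_{ijca}-g_{ic}\Phi_{jkab}-g_{jc}\Phi_{kiab}-g_{kc}\Phi_{ijab},$$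 and $\Phi$ is self-dual: $\frac1{4!}\epsilon_{ijkl}{}^{abcd}\Phi_{abcd}=\Phi_{ijkl}$, with $\epsilon$ the volume form of $g$. Square brackets denote antisymmetrisation with weight one; indices between vertical bars are excluded from it. A $k$-form has components $\omega=\frac1{k!}\omega_{a_1\dots a_k}dx^{a_1}\wedge\dots\wedge dx^{a_k}$, so $(d\Phi)_{aijkl}=5\,\partial_{[a}\Phi_{ijkl]}$. The Hodge star on 5-forms is $(\star\omega)_{mnr}=\frac{1}{5!}\epsilon_{mnr}{}^{aijkl}\omega_{aijkl}$. Every Cayley form $\Phi$ has a torsion 3-form, i.e. a 3-form $T\in\Lambda^3$ satisfying $\nabla_i\Phi_{abcd}=4\,T_{i[a}{}^{p}\Phi_{|p|bcd]}$, where $\nabla$ is the Levi-Civita connection of the metric $g$ determined by $\Phi$. *)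

(* Defs.v *)
(* MathComp + MathComp-Analysis. *)
From HB Require Import structures.
From mathcomp Require Import all_boot all_order all_algebra all_fingroup.
From mathcomp Require Import all_classical all_reals all_analysis.

Set Implicit Arguments.
Unset Strict Implicit.
Unset Printing Implicit Defensive.

Import Order.TTheory GRing.Theory Num.Theory.
Import numFieldNormedType.Exports.

Local Open Scope classical_set_scope.
Local Open Scope ring_scope.

(** * Multilinear algebra on R^n, in components *)

(* A covariant k-tensor on R^n is given by its components w_{t_1 ... t_k}. *)
Definition ctensor (R : realType) (n k : nat) := k.-tuple 'I_n -> R.

Section Algebra.
Variables (R : realType) (n : nat).

Definition permute_tuple k (s : 'S_k) (t : k.-tuple 'I_n) : k.-tuple 'I_n :=
  [tuple tnth t (s m) | m < k].

Definition is_alternating k (w : ctensor R n k) :=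
  forall (s : 'S_k) t, w (permute_tuple s t) = (-1) ^+ s * w t.

Definition alt_tensors k : set (ctensor R n k) := [set w | is_alternating w].

(* antisymmetrisation w_{[t_1 ... t_k]}, with weight one *)
Definition antisym k (w : ctensor R n k) : ctensor R n k := fun t =>
  (k`!)%:R^-1 * \sum_(s : 'S_k) (-1) ^+ s * w (permute_tuple s t).

(* the elementary form dx^{q_1} /\ ... /\ dx^{q_k} *)
Definition dx k (q : k.-tuple 'I_n) : ctensor R n k := fun t =>
  \det (\matrix_(a < k, b < k) (tnth q a == tnth t b)%:R).

(* A^* w, where A acts on column vectors *)
Definition pullback k (A : 'M[R]_n) (w : ctensor R n k) : ctensor R n k :=
  fun t => \sum_(s : k.-tuple 'I_n) (\prod_(m < k) A (tnth s m) (tnth t m)) * w s.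

Definition metric_mx (g : ctensor R n 2) : 'M[R]_n :=
  \matrix_(i, j) g [tuple i; j].

(* g^{ij} *)
Definition inv_metric (g : ctensor R n 2) (i j : 'I_n) : R :=
  invmx (metric_mx g) i j.

(* w with all its indices raised *)
Definition raise k (g : ctensor R n 2) (w : ctensor R n k) : ctensor R n k :=
  fun u => \sum_(v : k.-tuple 'I_n)
    (\prod_(m < k) inv_metric g (tnth u m) (tnth v m)) * w v.

End Algebra.

(** * Smooth functions on open subsets of R^n *)

Section Calculus.
Variables (R : realType) (n : nat).

Definition partial (a : 'I_n) (f : 'rV[R]_n -> R) : 'rV[R]_n -> R :=
  fun x => 'D_(delta_mx 0 a) f x.

Fixpoint Ck (k : nat) (U : set 'rV[R]_n) (f : 'rV[R]_n -> R) : Prop :=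
  (forall x, U x -> {for x, continuous f}) /\
  match k with
  | 0 => True
  | k'.+1 => forall a : 'I_n,
      (forall x, U x -> derivable f x (delta_mx 0 a)) /\ Ck k' U (partial a f)
  end.

Definition smooth (U : set 'rV[R]_n) (f : 'rV[R]_n -> R) := forall k, Ck k U f.

(* entry (a, b) is the derivative of the a-th component along x^b *)
Definition jacobian_mx (f : 'rV[R]_n -> 'rV[R]_n) (x : 'rV[R]_n) : 'M[R]_n :=
  \matrix_(a, b) partial b (fun y => f y 0 a) x.

End Calculus.

(** * Smooth manifolds *)

Record smoothManifold (R : realType) (n : nat) := SmoothManifold {
  points :> topologicalType;
  chart : Type;
  chart_dom : chart -> set points;
  coords : chart -> points -> 'rV[R]_n;
  coords_inv : chart -> 'rV[R]_n -> points;
  manifold_hausdorff : hausdorff_space points;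
  manifold_second_countable : @second_countable points;
  chart_dom_open : forall c, open (chart_dom c);
  chart_cover : forall p, exists c, chart_dom c p;
  chart_im_open : forall c, open (coords c @` chart_dom c);
  coordsK : forall c p, chart_dom c p -> coords_inv c (coords c p) = p;
  coords_continuous : forall c, {within chart_dom c, continuous (coords c)};
  coords_inv_continuous : forall c,
    {within coords c @` chart_dom c, continuous (coords_inv c)};
  transition_smooth : forall c c' (a : 'I_n),
    smooth (coords c @` (chart_dom c `&` chart_dom c'))
           (fun x => coords c' (coords_inv c x) 0 a)
}.

Section Manifolds.
Variables (R : realType) (n : nat) (M : smoothManifold R n).

Definition chart_im (c : chart M) : set 'rV[R]_n := coords c @` chart_dom c.

Definition overlap (c c' : chart M) : set 'rV[R]_n :=
  coords c @` (chart_dom c `&` chart_dom c').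

Definition transition (c c' : chart M) (x : 'rV[R]_n) : 'rV[R]_n :=
  coords c' (coords_inv c x).

(* A covariant k-tensor field is given by its components in each chart, as
   functions of the coordinates; only the values on chart_im are relevant. *)
Definition comp_field k := chart M -> 'rV[R]_n -> ctensor R n k.

Definition eq_field k (w w' : comp_field k) :=
  forall c x, chart_im c x -> w c x = w' c x.

Definition tensor_field k (w : comp_field k) :=
  (forall c t, smooth (chart_im c) (fun x => w c x t)) /\
  (forall c c' x, overlap c c' x ->
     w c x = pullback (jacobian_mx (transition c c') x)
                      (w c' (transition c c' x))).

Definition diff_form k : set (comp_field k) := [set w |
  tensor_field w /\ forall c x, chart_im c x -> is_alternating (w c x)].

Definition riemannian_metric (g : comp_field 2) :=
  tensor_field g /\
  forall c x, chart_im c x ->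
    (forall i j, g c x [tuple i; j] = g c x [tuple j; i]) /\
    (forall v : 'rV[R]_n, v != 0 ->
       0 < \sum_i \sum_j v 0 i * v 0 j * g c x [tuple i; j]).

(* (d w)_{a t_1 ... t_k} = (k + 1) \partial_{[a} w_{t_1 ... t_k]} *)
Definition ext_d k (w : comp_field k) : comp_field k.+1 := fun c x t =>
  k.+1%:R * antisym (fun u : k.+1.-tuple 'I_n =>
    partial (thead u) (fun y => w c y [tuple of behead u]) x) t.

(* Gam c x p i a stands for the coefficient \Gamma^p_{ia} *)
Definition connection_coef := chart M -> 'rV[R]_n -> 'I_n -> 'I_n -> 'I_n -> R.

Definition subst_tuple k (t : k.-tuple 'I_n) (m : 'I_k) (p : 'I_n) :
  k.-tuple 'I_n := [tuple if l == m then p else tnth t l | l < k].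

(* nabla Gam w c x i t is (\nabla_i w)_t *)
Definition nabla (Gam : connection_coef) k (w : comp_field k)
    (c : chart M) (x : 'rV[R]_n) (i : 'I_n) : ctensor R n k := fun t =>
  partial i (fun y => w c y t) x
  - \sum_(m < k) \sum_p Gam c x p i (tnth t m) * w c x (subst_tuple t m p).

(* Torsion-free and metric.  These two conditions determine the coefficients
   in each chart, so their transformation law need not be required. *)
Definition levi_civita (g : comp_field 2) (Gam : connection_coef) :=
  forall c x, chart_im c x ->
    (forall p i j, Gam c x p i j = Gam c x p j i) /\
    (forall i t, nabla Gam g c x i t = 0).

End Manifolds.

(** * Cayley forms *)

Section Cayley.
Variable R : realType.

(* the index i of the coordinate x^i of R^8, numbered from 1 to 8 *)
Definition ix (i : nat) : 'I_8 := inord i.-1.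

Definition dx4 (i j k l : nat) : ctensor R 8 4 :=
  dx R [tuple ix i; ix j; ix k; ix l].

(* The sign is the one for which the contraction identity
     Phi_{ijkp} Phi_{abc}^p = g_{ia} g_{jb} g_{kc} + ... - g_{ia} Phi_{jkbc} - ...
   holds with the Euclidean metric; the opposite form satisfies the identity
   with + g_{ia} Phi_{jkbc} + ..., and is the usual Cayley form of the
   calibrated geometry literature. Both are self-dual for dx^{12345678}. *)
Definition Phi0 : ctensor R 8 4 := fun t =>
  - (dx4 1 2 3 4 t + dx4 1 2 5 6 t + dx4 1 2 7 8 t + dx4 1 3 5 7 t
     - dx4 1 3 6 8 t - dx4 1 4 5 8 t - dx4 1 4 6 7 t - dx4 2 3 5 8 t
     - dx4 2 3 6 7 t - dx4 2 4 5 7 t + dx4 2 4 6 8 t + dx4 3 4 5 6 t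
     + dx4 3 4 7 8 t + dx4 5 6 7 8 t).

Definition g0 : ctensor R 8 2 := fun t => (tnth t ord0 == tnth t ord_max)%:R.

Definition vol0 : ctensor R 8 8 := dx R [tuple i | i < 8].

Definition cayley_form (M : smoothManifold R 8) (Phi : comp_field M 4) :=
  diff_form Phi /\
  forall c x, chart_im c x ->
    exists2 A : 'M[R]_8, A \in unitmx & Phi c x = pullback A Phi0.

(* g and eps are the metric and the volume form determined by Phi.  As the
   stabiliser of Phi0 in GL(8, R) is contained in SO(8), the values of g and
   eps do not depend on the choice of A. *)
Definition determined_by (M : smoothManifold R 8) (Phi : comp_field M 4)
    (g : comp_field M 2) (eps : comp_field M 8) :=
  riemannian_metric g /\
  forall c x, chart_im c x ->
    exists A : 'M[R]_8, [/\ A \in unitmx, Phi c x = pullback A Phi0,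
      g c x = pullback A g0 & eps c x = pullback A vol0].

(* (star w)_{mnr} = 1/5! eps_{mnr}^{aijkl} w_{aijkl} *)
Definition hodge5 (g : ctensor R 8 2) (eps : ctensor R 8 8)
    (w : ctensor R 8 5) : ctensor R 8 3 := fun t =>
  (5`!)%:R^-1 * \sum_(u : 5.-tuple 'I_8) eps [tuple of t ++ u] * raise g w u.

(* Phi_{ij}^{pq} *)
Definition raise34 (g : ctensor R 8 2) (Phi : ctensor R 8 4)
    (i j p q : 'I_8) : R :=
  \sum_r \sum_s inv_metric g p r * inv_metric g q s * Phi [tuple i; j; r; s].

(* Phi_{ij}^{pq} gam_{kpq} *)
Definition Phi_contr (g : ctensor R 8 2) (Phi : ctensor R 8 4)
    (gam : ctensor R 8 3) (i j k : 'I_8) : R :=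
  \sum_p \sum_q raise34 g Phi i j p q * gam [tuple k; p; q].

Definition J3 (g : ctensor R 8 2) (Phi : ctensor R 8 4)
    (gam : ctensor R 8 3) : ctensor R 8 3 := fun t =>
  3%:R / 2%:R * antisym (fun u : 3.-tuple 'I_8 =>
    Phi_contr g Phi gam (tnth u (inord 0)) (tnth u (inord 1))
                        (tnth u (inord 2))) t.

Definition J3_field (M : smoothManifold R 8) (g : comp_field M 2)
    (Phi : comp_field M 4) (gam : comp_field M 3) : comp_field M 3 :=
  fun c x => J3 (g c x) (Phi c x) (gam c x).

Definition hodge5_field (M : smoothManifold R 8) (g : comp_field M 2)
    (eps : comp_field M 8) (w : comp_field M 5) : comp_field M 3 :=
  fun c x => hodge5 (g c x) (eps c x) (w c x).

(* T_{ia}^p Phi_{pbcd} *)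
Definition torsion_contr (g : ctensor R 8 2) (Phi : ctensor R 8 4)
    (T : ctensor R 8 3) (i a b c d : 'I_8) : R :=
  \sum_p \sum_q T [tuple i; a; q] * inv_metric g q p * Phi [tuple p; b; c; d].

(* \nabla_i Phi_{abcd} = 4 T_{i[a}^p Phi_{|p|bcd]} *)
Definition torsion_form (M : smoothManifold R 8) (g : comp_field M 2)
    (Gam : connection_coef M) (Phi : comp_field M 4) (T : comp_field M 3) :=
  diff_form T /\
  forall c x, chart_im c x -> forall i t,
    nabla Gam Phi c x i t =
    4%:R * antisym (fun u : 4.-tuple 'I_8 =>
      torsion_contr (g c x) (Phi c x) (T c x) i
        (tnth u (inord 0)) (tnth u (inord 1))
        (tnth u (inord 2)) (tnth u (inord 3))) t.

End Cayley.

(* Main.v *)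
(* At a point choose a frame [A] in which [Phi], [g] and the volume form are the
   pullbacks of the Euclidean [Phi0], [g0] and [vol0]. All the operators involved
   commute with pullbacks, so algebraic identities need only be proved for
   [Phi0], where an identity that is linear in an alternating 3-tensor amounts
   to finitely many identities between integers.
   Since the Levi-Civita connection is symmetric, [d Phi] is the antisymmetrised
   covariant derivative, i.e. 20 times the antisymmetrised contraction of [T]
   with [Phi]; the star of the latter is [2 J3 T] by such a linear identity.
   Another one is [J3^2 + 5 J3 - 6 = 0] (the eigenvalues are 1 and -6), which
   makes [(J3 + 5) / 6] the inverse of [J3]; being polynomial in [J3], it
   preserves smooth tensor fields. *)
Require Import Defs.
From mathcomp Require Import all_boot all_order all_algebra all_fingroup.
From mathcomp Require Import all_classical all_reals all_analysis.
From mathcomp Require Import ring lra zify.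

Set Implicit Arguments.
Unset Strict Implicit.
Unset Printing Implicit Defensive.

Import Order.TTheory GRing.Theory Num.Theory.
Import numFieldNormedType.Exports.

Local Open Scope classical_set_scope.
Local Open Scope ring_scope.

(** * Tuples, Kronecker powers and pullbacks *)

(** The Euclidean identities concern real-valued functions of tuples over ['I_8], with determinants
    and inverse matrices inside, and nothing there reduces by computation. A parallel model on which
    [vm_compute] runs is therefore built: indices are natural numbers, coefficients lie in [int],
    the sign of an index word is found by comparisons, and the unknown 3-tensor stays symbolic, a
    linear functional of it being a list of coefficients and index words. [lin_eval] ties the model
    to actual tensors. Both sides of each identity are alternating, so only the 56 increasing
    triples are tested.

    Equivariance is not proved operator by operator. Each operator is, up to constants and
    antisymmetrisation, a contraction of two tensors along their last slots, and a single
    computation with Kronecker powers covers this common shape. *)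

Section TupleSums.
Variables (I : finType) (V : nmodType).

Lemma sum_tuple0 (F : 0.-tuple I -> V) : \sum_u F u = F [tuple].
Proof.
rewrite (bigD1 [tuple]) //= big1 ?addr0 // => u.
by case: eqP => // neq_u _; case: neq_u; exact: tuple0.
Qed.

Definition tleft a b (t : (a + b).-tuple I) : a.-tuple I :=
  [tuple tnth t (lshift b m) | m < a].

Definition tright a b (t : (a + b).-tuple I) : b.-tuple I :=
  [tuple tnth t (rshift a m) | m < b].

Lemma tleft_cat a b (s : a.-tuple I) (t : b.-tuple I) :
  tleft [tuple of s ++ t] = s.
Proof. by apply: eq_from_tnth => m; rewrite tnth_mktuple tnth_lshift. Qed.

Lemma tright_cat a b (s : a.-tuple I) (t : b.-tuple I) :
  tright [tuple of s ++ t] = t.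
Proof. by apply: eq_from_tnth => m; rewrite tnth_mktuple tnth_rshift. Qed.

Lemma cat_tleft_tright a b (t : (a + b).-tuple I) :
  [tuple of tleft t ++ tright t] = t.
Proof.
apply: eq_from_tnth => m; case: (split_ordP m) => j ->.
  by rewrite tnth_lshift tnth_mktuple.
by rewrite tnth_rshift tnth_mktuple.
Qed.

Lemma tleft0 a (t : (a + 0).-tuple I) : tleft t = t :> seq I.
Proof. by rewrite -[t in RHS]cat_tleft_tright (tuple0 (tright t)) /= cats0. Qed.

Lemma sum_tuple_cat a b (F : (a + b).-tuple I -> V) :
  \sum_u F u = \sum_(s : a.-tuple I) \sum_(t : b.-tuple I) F [tuple of s ++ t].
Proof.
rewrite pair_bigA /=.
rewrite (reindex (fun p : a.-tuple I * b.-tuple I => [tuple of p.1 ++ p.2])) //=.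
exists (fun t => (tleft t, tright t)) => [[s t] _|t _] /=.
  by rewrite tleft_cat tright_cat.
exact: cat_tleft_tright.
Qed.

Lemma sum_tuple_cons k (F : k.+1.-tuple I -> V) :
  \sum_u F u = \sum_i \sum_(u : k.-tuple I) F [tuple of i :: u].
Proof.
rewrite pair_bigA /=.
rewrite (reindex (fun p : I * k.-tuple I => [tuple of p.1 :: p.2])) //=.
exists (fun t => (thead t, [tuple of behead t])) => [[s t] _|t _] /=.
  by congr (_, _); apply: val_inj.
by rewrite -tuple_eta.
Qed.

End TupleSums.

Lemma sum_tuple_prod (R : comPzSemiRingType) (I : finType) k (F : 'I_k -> I -> R) :
  \sum_(u : k.-tuple I) \prod_(m < k) F m (tnth u m) = \prod_(m < k) \sum_i F m i.
Proof.
rewrite bigA_distr_bigA (reindex (@tuple_of_finfun I k)) /=.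
  apply: eq_bigr => f _; apply: eq_bigr => m _.
  by rewrite -{2}[f]tuple_of_finfunK ffunE.
exists (@finfun_of_tuple I k) => t _; first exact: tuple_of_finfunK.
exact: finfun_of_tupleK.
Qed.

Section Tensors.
Variables (R : realType) (n : nat).
Implicit Types (A B G : 'M[R]_n).

(* The [k]-th Kronecker power of [A], so that [pullback A w t] is
   [\sum_s kron A s t * w s]. *)
Definition kron k A (s t : k.-tuple 'I_n) : R :=
  \prod_(m < k) A (tnth s m) (tnth t m).

Lemma kron_cat a b A (s t : a.-tuple 'I_n) (s' t' : b.-tuple 'I_n) :
  kron A [tuple of s ++ s'] [tuple of t ++ t'] = kron A s t * kron A s' t'.
Proof.
rewrite /kron big_split_ord /=.
by congr (_ * _); apply: eq_bigr => m _; rewrite ?tnth_lshift ?tnth_rshift.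
Qed.

Lemma kron_cons k A i j (s t : k.-tuple 'I_n) :
  kron A [tuple of i :: s] [tuple of j :: t] = A i j * kron A s t.
Proof.
rewrite /kron big_ord_recl; congr (_ * _).
by apply: eq_bigr => m _; rewrite !tnthS.
Qed.

Lemma kron0 A (s t : 0.-tuple 'I_n) : kron A s t = 1.
Proof. exact: big_ord0. Qed.

Lemma kron_tr k A (s t : k.-tuple 'I_n) : kron A^T s t = kron A t s.
Proof. by apply: eq_bigr => m _; rewrite mxE. Qed.

Lemma kron_mul k A B (s t : k.-tuple 'I_n) :
  kron (A *m B) s t = \sum_u kron A s u * kron B u t.
Proof.
rewrite /kron -[LHS]/(\prod_(m < k) (A *m B) (tnth s m) (tnth t m)).
under eq_bigr do rewrite mxE.
rewrite -(sum_tuple_prod (fun m i => A (tnth s m) i * B i (tnth t m))).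
by apply: eq_bigr => u _; rewrite big_split.
Qed.

Lemma kron1 k (s t : k.-tuple 'I_n) : kron 1%:M s t = (s == t)%:R.
Proof.
rewrite /kron; have [->|/eqP neq_st] := eqVneq s t.
  by rewrite big1 // => m _; rewrite mxE eqxx.
apply/eqP; rewrite prodf_seq_eq0; apply: contra_notT neq_st => /hasPn h.
apply: eq_from_tnth => m; have := h m (mem_index_enum _).
by rewrite mxE /=; case: (tnth s m =P tnth t m); rewrite ?eqxx.
Qed.

Lemma kron_permute k A s (t u : k.-tuple 'I_n) :
  kron A (permute_tuple s t) (permute_tuple s u) = kron A t u.
Proof.
rewrite /kron [RHS](reindex_inj (@perm_inj _ s)) /=.
by apply: eq_bigr => m _; rewrite !tnth_mktuple.
Qed.

Lemma permute_tuple1 k (t : k.-tuple 'I_n) : permute_tuple 1%g t = t.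
Proof. by apply: eq_from_tnth => m; rewrite tnth_mktuple perm1. Qed.

Lemma permute_tupleM k s s' (t : k.-tuple 'I_n) :
  permute_tuple s (permute_tuple s' t) = permute_tuple (s * s')%g t.
Proof. by apply: eq_from_tnth => m; rewrite !tnth_mktuple permM. Qed.

Lemma permute_tuple_bij k s : bijective (@permute_tuple n k s).
Proof.
exists (permute_tuple s^-1%g) => t;
  by rewrite permute_tupleM ?mulVg ?mulgV permute_tuple1.
Qed.

Lemma pullbackE k A (w : ctensor R n k) t :
  pullback A w t = \sum_s kron A s t * w s.
Proof. by []. Qed.

Lemma pullback1 k (w : ctensor R n k) : pullback 1%:M w = w.
Proof.
apply/funext => t; rewrite pullbackE (bigD1 t) //= kron1 eqxx mul1r big1 ?addr0 //.
by move=> s /negPf neq_st; rewrite kron1 neq_st mul0r.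
Qed.

Lemma pullbackM k A B (w : ctensor R n k) :
  pullback A (pullback B w) = pullback (B *m A) w.
Proof.
apply/funext => t; rewrite !pullbackE.
under eq_bigr do rewrite pullbackE mulr_sumr.
rewrite exchange_big /=; apply: eq_bigr => s _.
rewrite kron_mul mulr_suml; apply: eq_bigr => u _; ring.
Qed.

Lemma pullback_permute k A (w : ctensor R n k) s t :
  pullback A w (permute_tuple s t) = pullback A (fun u => w (permute_tuple s u)) t.
Proof.
rewrite !pullbackE (reindex (permute_tuple s)) /=; last first.
  exact/onW_bij/permute_tuple_bij.
by under eq_bigr do rewrite kron_permute.
Qed.

Lemma pullback_alt k A (w : ctensor R n k) :
  is_alternating w -> is_alternating (pullback A w).
Proof.
move=> altw s t; rewrite pullback_permute !pullbackE mulr_sumr.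
by apply: eq_bigr => u _; rewrite altw mulrCA.
Qed.

Lemma pullbackZ k A c (w : ctensor R n k) :
  pullback A (fun t => c * w t) = fun t => c * pullback A w t.
Proof.
apply/funext => t; rewrite !pullbackE mulr_sumr.
by apply: eq_bigr => u _; rewrite mulrCA.
Qed.

Lemma pullback_antisym k A (w : ctensor R n k) :
  pullback A (antisym w) = antisym (pullback A w).
Proof.
apply/funext => t; rewrite /antisym pullbackZ; congr (_ * _).
under [RHS]eq_bigr do rewrite pullback_permute pullbackE mulr_sumr.
rewrite exchange_big pullbackE; apply: eq_bigr => u _.
by rewrite mulr_sumr; apply: eq_bigr => s _; rewrite mulrCA.
Qed.

Lemma antisym_permute k (w : ctensor R n k) s :
  antisym (fun t => w (permute_tuple s t)) = fun t => (-1) ^+ s * antisym w t.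
Proof.
apply/funext => t; rewrite /antisym mulrCA; congr (_ * _).
rewrite mulr_sumr [RHS](reindex_inj (mulgI s)) /=.
apply: eq_bigr => s' _; rewrite permute_tupleM odd_permM signr_addb.
by rewrite !mulrA -signr_addb addbb mul1r.
Qed.

Lemma antisym_alt k (w : ctensor R n k) : is_alternating (antisym w).
Proof.
move=> s t; rewrite /antisym mulrCA; congr (_ * _).
rewrite mulr_sumr [RHS](reindex_inj (mulIg s)) /=.
apply: eq_bigr => s' _; rewrite permute_tupleM odd_permM addbC signr_addb.
by rewrite !mulrA -signr_addb addbb mul1r.
Qed.

Lemma fact_neq0 k : (k`!)%:R != 0 :> R.
Proof. by rewrite pnatr_eq0 -lt0n fact_gt0. Qed.

Lemma antisym_id k (w : ctensor R n k) : is_alternating w -> antisym w = w.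
Proof.
move=> altw; apply/funext => t; rewrite /antisym.
under eq_bigr do rewrite altw mulrA -signr_addb addbb mul1r.
by rewrite sumr_const card_Sn -[X in _ * X]mulr_natl mulrA mulVf ?mul1r ?fact_neq0.
Qed.

Lemma antisymZ k c (w : ctensor R n k) :
  antisym (fun t => c * w t) = fun t => c * antisym w t.
Proof.
apply/funext => t; rewrite /antisym mulrCA; congr (_ * _).
by rewrite mulr_sumr; apply: eq_bigr => s _; rewrite mulrCA.
Qed.

Lemma antisymD k (w w' : ctensor R n k) :
  antisym (fun t => w t + w' t) = fun t => antisym w t + antisym w' t.
Proof.
apply/funext => t; rewrite /antisym -mulrDr -big_split /=; congr (_ * _).
by apply: eq_bigr => s _; rewrite mulrDr.
Qed.

Lemma antisym_sum k (I : Type) (r : seq I) (w : I -> ctensor R n k) t :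
  antisym (fun u => \sum_(i <- r) w i u) t = \sum_(i <- r) antisym (w i) t.
Proof.
rewrite /antisym -mulr_sumr exchange_big /=; congr (_ * _).
by apply: eq_bigr => s _; rewrite mulr_sumr.
Qed.

Lemma antisym_tperm_inv k (w : ctensor R n k) (i j : 'I_k) t : i != j ->
  (forall u, w (permute_tuple (tperm i j) u) = w u) -> antisym w t = 0.
Proof.
move=> neq_ij inv_w.
have := congr1 (fun f => f t) (antisym_permute w (tperm i j)) => /=.
have -> : (fun u => w (permute_tuple (tperm i j) u)) = w by apply/funext.
rewrite odd_tperm neq_ij expr1; lra.
Qed.

(** A permutation of the last [k] slots extends, with the same sign, to one of all [k.+1] slots
    fixing the first. The outer antisymmetrisation absorbs it, so the [k!] inner terms all agree. *)
Lemma antisym_tail k (h : 'I_n -> ctensor R n k) :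
  antisym (fun u : k.+1.-tuple 'I_n => antisym (h (thead u)) [tuple of behead u])
  = antisym (fun u : k.+1.-tuple 'I_n => h (thead u) [tuple of behead u]).
Proof.
apply/funext => t; rewrite {2}/antisym antisymZ antisym_sum.
pose w (u : k.+1.-tuple 'I_n) := h (thead u) [tuple of behead u].
transitivity ((k`!)%:R^-1 * \sum_(s : 'S_k) antisym w t); last first.
  by rewrite sumr_const card_Sn -[X in _ * X]mulr_natl mulrA mulVf ?mul1r ?fact_neq0.
congr (_ * _); apply: eq_bigr => s _; rewrite antisymZ.
pose s' := lift_perm ord0 ord0 s.
have -> : (fun u : k.+1.-tuple 'I_n => h (thead u) (permute_tuple s [tuple of behead u]))
  = fun u => w (permute_tuple s' u).
  apply/funext => u; rewrite /w; congr (h _ _).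
    by rewrite /thead tnth_mktuple lift_perm_id.
  apply: eq_from_tnth => m; rewrite !tnth_behead !tnth_mktuple.
  rewrite tnth_behead; congr tnth.
  have e (j : 'I_k) : inord j.+1 = lift ord0 j :> 'I_k.+1.
    by apply: val_inj; rewrite /= inordK // ltnS.
  by rewrite !e lift_perm_lift.
by rewrite antisym_permute odd_lift_perm addbF mulrA -signr_addb addbb mul1r.
Qed.

(** The shape shared by [contr3], [torsion5] and [hodge5]: the last [b] slots of both factors are
    joined through [G], in practice an inverse metric or its transpose. *)
Definition contr a b c G (w : ctensor R n (a + b)) (w' : ctensor R n (c + b)) :
    ctensor R n (a + c) := fun t =>
  \sum_(v : b.-tuple 'I_n) \sum_(u : b.-tuple 'I_n)
    kron G v u * w [tuple of tleft t ++ u] * w' [tuple of tright t ++ v].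

(** Free slots keep their factor of [A], while the factors on contracted slots gather around [G].
    For [G] the inverse of the pulled-back metric, [A *m G *m A^T] is the inverse of the original
    one, by [inv_metric_pullback]. *)
Lemma contr_pullback a b c A G (w : ctensor R n (a + b)) (w' : ctensor R n (c + b)) :
  contr G (pullback A w) (pullback A w') =
  pullback A (contr (A *m G *m A^T) w w').
Proof.
apply/funext => t; rewrite -[t]cat_tleft_tright.
move: (tleft t) (tright t) => {t} x y.
rewrite pullbackE sum_tuple_cat.
transitivity (\sum_(x' : a.-tuple 'I_n) \sum_(y' : c.-tuple 'I_n)
   \sum_(v' : b.-tuple 'I_n) \sum_(u' : b.-tuple 'I_n)
   \sum_(v : b.-tuple 'I_n) \sum_(u : b.-tuple 'I_n)
   kron A x' x * kron A y' y *
   (kron A v' v * kron G v u * kron A u' u *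
    w [tuple of x' ++ u'] * w' [tuple of y' ++ v'])).
  rewrite /contr tleft_cat tright_cat.
  transitivity (\sum_(v : b.-tuple 'I_n) \sum_(u : b.-tuple 'I_n)
     \sum_(x' : a.-tuple 'I_n) \sum_(u' : b.-tuple 'I_n)
     \sum_(y' : c.-tuple 'I_n) \sum_(v' : b.-tuple 'I_n)
     kron A x' x * kron A y' y *
   (kron A v' v * kron G v u * kron A u' u *
    w [tuple of x' ++ u'] * w' [tuple of y' ++ v'])).
    apply: eq_bigr => v _; apply: eq_bigr => u _.
    rewrite !pullbackE !sum_tuple_cat mulrAC mulr_sumr.
    apply: eq_bigr => x' _; rewrite mulr_sumr.
    apply: eq_bigr => u' _; rewrite mulrAC mulr_sumr.
    apply: eq_bigr => y' _; rewrite mulr_sumr.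
    apply: eq_bigr => v' _; rewrite !kron_cat; ring.
  under eq_bigr do rewrite exchange_big.
  rewrite exchange_big; apply: eq_bigr => x' _.
  under eq_bigr => v _ do under eq_bigr => u _ do rewrite exchange_big.
  under eq_bigr => v _ do rewrite exchange_big.
  rewrite exchange_big; apply: eq_bigr => y' _.
  under eq_bigr => v _ do under eq_bigr => u _ do rewrite exchange_big.
  under eq_bigr => v _ do rewrite exchange_big.
  rewrite exchange_big; apply: eq_bigr => v' _.
  under eq_bigr => v _ do rewrite exchange_big.
  by rewrite exchange_big.
apply: eq_bigr => x' _; apply: eq_bigr => y' _.
rewrite kron_cat /contr tleft_cat tright_cat mulr_sumr.
apply: eq_bigr => v' _; rewrite mulr_sumr; apply: eq_bigr => u' _.
under eq_bigr do rewrite -mulr_sumr -mulr_suml -mulr_suml.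
rewrite -mulr_sumr -!mulr_suml !kron_mul; congr (_ * (_ * _ * _)).
under [RHS]eq_bigr do rewrite kron_mul mulr_suml.
rewrite exchange_big; apply: eq_bigr => v _; apply: eq_bigr => u _.
by rewrite kron_tr.
Qed.

End Tensors.

(** * Equivariance of [J3], the torsion contraction and the Hodge star *)

Section Metrics.
Variables (R : realType) (n : nat).
Implicit Types (A : 'M[R]_n) (g : ctensor R n 2).

Lemma is_alternating_tperm k (w : ctensor R n k) :
  (forall i j t, i != j -> w (permute_tuple (tperm i j) t) = - w t) ->
  is_alternating w.
Proof.
move=> alt_w s; have [ts -> all_ts] := prod_tpermP s.
elim: ts all_ts => [_|[i j] ts IH /= /andP[neq_ij all_ts]] t.
  by rewrite big_nil permute_tuple1 odd_perm1 mul1r.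
rewrite big_cons -permute_tupleM alt_w // IH // odd_permM odd_tperm neq_ij.
by rewrite signrN mulNr.
Qed.

Lemma alt_tperm k (w : ctensor R n k) i j t :
  is_alternating w -> i != j -> w (permute_tuple (tperm i j) t) = - w t.
Proof. by move=> alt_w neq_ij; rewrite alt_w odd_tperm neq_ij mulN1r. Qed.

Lemma tnth_tuple3 (T : Type) (i j k : T) (m : 'I_3) :
  tnth [tuple i; j; k] m = if m == inord 0 then i else if m == inord 1 then j else k.
Proof.
rewrite (tnth_nth i) /= -!val_eqE /= !inordK //.
by case: m => [[|[|[|]]]].
Qed.

Lemma tuple3_eta (T : Type) (t : 3.-tuple T) :
  t = [tuple tnth t (inord 0); tnth t (inord 1); tnth t (inord 2)].
Proof.
apply: eq_from_tnth => m; rewrite tnth_tuple3 -!val_eqE /= !inordK //.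
by case: m => [[|[|[|]]]] //= lt_m3; congr tnth; apply: val_inj; rewrite /= inordK.
Qed.

Lemma tuple3P (T : Type) (t : 3.-tuple T) : exists i j k, t = [tuple i; j; k].
Proof. by do 3!eexists; exact: tuple3_eta. Qed.

Lemma is_alternating3 (w : ctensor R n 3) :
  (forall i j k, w [tuple j; i; k] = - w [tuple i; j; k]) ->
  (forall i j k, w [tuple i; k; j] = - w [tuple i; j; k]) ->
  is_alternating w.
Proof.
move=> w12 w23; apply: is_alternating_tperm => i j t.
wlog lt_ij : i j / (i < j)%N.
  move=> wlg neq_ij; have := neq_ij; rewrite -val_eqE neq_ltn => /orP[] lt_ij.
    exact: wlg.
  by rewrite tpermC wlg // eq_sym.
move=> _; rewrite [t]tuple3_eta; move: (tnth _ _) (tnth _ _) (tnth _ _) => x y z.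
rewrite [permute_tuple _ _]tuple3_eta !tnth_mktuple !tnth_tuple3.
have i0 : Ordinal (isT : (0 < 3)%N) = inord 0 by apply: val_inj; rewrite /= inordK.
have i1 : Ordinal (isT : (1 < 3)%N) = inord 1 by apply: val_inj; rewrite /= inordK.
have i2 : Ordinal (isT : (2 < 3)%N) = inord 2 by apply: val_inj; rewrite /= inordK.
rewrite -i0 -i1 -i2.
case: i j lt_ij => [[|[|[|]]]] //= hi [[|[|[|]]]] //= hj _.
- have -> : Ordinal hi = Ordinal (isT : (0 < 3)%N) by apply: val_inj.
  have -> : Ordinal hj = Ordinal (isT : (1 < 3)%N) by apply: val_inj.
  by rewrite tpermL tpermR tpermD //= w12.
- have -> : Ordinal hi = Ordinal (isT : (0 < 3)%N) by apply: val_inj.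
  have -> : Ordinal hj = Ordinal (isT : (2 < 3)%N) by apply: val_inj.
  by rewrite tpermL tpermR tpermD //= w12 w23 w12 opprK.
- have -> : Ordinal hi = Ordinal (isT : (1 < 3)%N) by apply: val_inj.
  have -> : Ordinal hj = Ordinal (isT : (2 < 3)%N) by apply: val_inj.
  by rewrite tpermL tpermR tpermD //= w23.
Qed.

Lemma alt_swap k (w : ctensor R n k) (i j : 'I_k) t u :
  is_alternating w -> i != j -> tnth u i = tnth t j -> tnth u j = tnth t i ->
  (forall m, m != i -> m != j -> tnth u m = tnth t m) -> w u = - w t.
Proof.
move=> alt_w neq_ij ui uj um; rewrite -(alt_tperm _ alt_w neq_ij).
congr w; apply: eq_from_tnth => m; rewrite tnth_mktuple.
case: tpermP => [->|->|/eqP mi /eqP mj] //; exact: um.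
Qed.

Lemma alt4_swap12 (w : ctensor R n 4) i j k l :
  is_alternating w -> w [tuple j; i; k; l] = - w [tuple i; j; k; l].
Proof.
move=> alt_w.
apply: (@alt_swap _ w (Ordinal (isT : (0 < 4)%N)) (Ordinal (isT : (1 < 4)%N))) => //.
by case=> [[|[|[|[|m]]]] hm].
Qed.

Lemma alt4_swap23 (w : ctensor R n 4) i j k l :
  is_alternating w -> w [tuple i; k; j; l] = - w [tuple i; j; k; l].
Proof.
move=> alt_w.
apply: (@alt_swap _ w (Ordinal (isT : (1 < 4)%N)) (Ordinal (isT : (2 < 4)%N))) => //.
by case=> [[|[|[|[|m]]]] hm].
Qed.

Lemma alt4_swap34 (w : ctensor R n 4) i j k l :
  is_alternating w -> w [tuple i; j; l; k] = - w [tuple i; j; k; l].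
Proof.
move=> alt_w.
apply: (@alt_swap _ w (Ordinal (isT : (2 < 4)%N)) (Ordinal (isT : (3 < 4)%N))) => //.
by case=> [[|[|[|[|m]]]] hm].
Qed.

Lemma metric_pullback A g :
  metric_mx (pullback A g) = A^T *m metric_mx g *m A.
Proof.
apply/matrixP => i j; rewrite !mxE pullbackE sum_tuple_cons.
under [RHS]eq_bigr do rewrite !mxE mulr_suml.
rewrite [RHS]exchange_big; apply: eq_bigr => p _.
rewrite sum_tuple_cons; apply: eq_bigr => q _; rewrite sum_tuple0.
rewrite !mxE.
have -> : [tuple i; j] = [tuple of i :: [tuple of j :: [tuple]]] by apply: val_inj.
have -> : [tuple p; q] = [tuple of p :: [tuple of q :: [tuple]]] by apply: val_inj.
rewrite !kron_cons kron0; ring.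
Qed.

Lemma inv_metric_pullback A g : A \in unitmx -> metric_mx g \in unitmx ->
  A *m invmx (metric_mx (pullback A g)) *m A^T = invmx (metric_mx g).
Proof.
move=> uA uG; rewrite metric_pullback.
set G := metric_mx g.
have uB : A^T *m G *m A \in unitmx by rewrite !unitmx_mul unitmx_tr uA uG.
have uAT : A^T \in unitmx by rewrite unitmx_tr.
apply: (can_inj (mulKmx uG)); rewrite mulmxV //.
apply: (can_inj (mulKmx uAT)); rewrite mulmx1.
by rewrite !mulmxA mulmxV // mul1mx.
Qed.

End Metrics.

Section Equivariance.
Variable R : realType.
Implicit Types (A : 'M[R]_8) (g : ctensor R 8 2) (Phi : ctensor R 8 4)
  (gam T : ctensor R 8 3).

Definition contr3 g Phi gam : ctensor R 8 3 := fun u =>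
  Phi_contr g Phi gam (tnth u (inord 0)) (tnth u (inord 1)) (tnth u (inord 2)).

Definition torsion5 g Phi T : ctensor R 8 5 := fun u =>
  torsion_contr g Phi T (tnth u (inord 0)) (tnth u (inord 1)) (tnth u (inord 2))
    (tnth u (inord 3)) (tnth u (inord 4)).

Lemma contr3E g Phi gam :
  contr3 g Phi gam = @contr R 8 2 2 1 (invmx (metric_mx g)) Phi gam.
Proof.
apply/funext => t; have [i [j [k ->]]] := tuple3P t.
rewrite /contr3 !tnth_tuple3 -!val_eqE /= !inordK //= /contr.
have -> : [tuple i; j; k] = [tuple of [tuple i; j] ++ [tuple k]] by apply: val_inj.
rewrite (@tleft_cat _ 2 1) (@tright_cat _ 2 1) sum_tuple_cons.
apply: eq_bigr => p _; rewrite sum_tuple_cons; apply: eq_bigr => q _.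
rewrite sum_tuple0 sum_tuple_cons mulr_suml; apply: eq_bigr => r _.
rewrite sum_tuple_cons mulr_suml; apply: eq_bigr => s _.
rewrite sum_tuple0 !kron_cons kron0 mulr1.
by congr (_ * Phi _ * gam _); apply: val_inj.
Qed.

Lemma alt4_rot Phi p b c d :
  is_alternating Phi -> Phi [tuple b; c; d; p] = - Phi [tuple p; b; c; d].
Proof.
move=> alt_Phi.
by rewrite alt4_swap34 // alt4_swap23 // opprK alt4_swap12.
Qed.

(* The metric contraction in [torsion_contr] joins the last slot of [T] to the
   first slot of [Phi]; moving the latter to the end costs a sign. *)
Lemma torsion5E g Phi T : (metric_mx g)^T = metric_mx g -> is_alternating Phi ->
  torsion5 g Phi T =
  fun u => - @contr R 8 2 1 3 (invmx (metric_mx g)) T Phi u.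
Proof.
move=> sym_g alt_Phi; apply/funext => t; rewrite -[t](@cat_tleft_tright _ 2 3).
have [b [c [d ->]]] := tuple3P (@tright _ 2 3 t).
move: (@tleft _ 2 3 t) => {t} ia.
have [i [a ->]] : exists i a, ia = [tuple i; a].
  case: ia => [[|i [|a [|? ?]]] //= sz]; exists i, a; exact: val_inj.
rewrite /contr tleft_cat tright_cat /torsion5 !(tnth_nth i) /= !inordK //=.
rewrite sum_tuple_cons -sumrN /torsion_contr; apply: eq_bigr => p _.
rewrite sum_tuple0 sum_tuple_cons -sumrN; apply: eq_bigr => q _.
rewrite sum_tuple0 kron_cons kron0 mulr1 /inv_metric.
have -> : invmx (metric_mx g) q p = invmx (metric_mx g) p q.
  by rewrite -[in RHS]sym_g -trmx_inv mxE.
rewrite -[T _ * _]mulrC -mulrN; congr (_ * T _ * _); first exact: val_inj.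
by rewrite -[Phi [tuple p; _; _; _]]opprK -alt4_rot //; congr (- Phi _); apply: val_inj.
Qed.

(** Raising five indices applies the fifth Kronecker power of the inverse metric, so the star
    contracts every slot of [w] and [c = 0]. The transpose appears because [raise] and [contr] list
    the two indices of the inverse metric in opposite orders. *)
Lemma hodge5E g eps (w : ctensor R 8 5) :
  hodge5 g eps w =
  fun t => (5`!)%:R^-1 * @contr R 8 3 5 0 (invmx (metric_mx g))^T eps w t.
Proof.
apply/funext => t; rewrite /hodge5 /contr; congr (_ * _).
rewrite exchange_big; apply: eq_bigr => u _.
rewrite /raise mulr_sumr; apply: eq_bigr => v _.
rewrite kron_tr mulrCA mulrA; congr (_ * eps _ * w _).
  by apply: val_inj => /=; rewrite (@tleft0 _ 3).
apply: val_inj; rewrite /= [X in _ = X ++ _]size0nil.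
  by [].
by rewrite size_map size_enum_ord.
Qed.

Lemma contr3_pullback A g Phi gam : A \in unitmx -> metric_mx g \in unitmx ->
  contr3 (pullback A g) (pullback A Phi) (pullback A gam) =
  pullback A (contr3 g Phi gam).
Proof. by move=> uA uG; rewrite !contr3E contr_pullback inv_metric_pullback. Qed.

Lemma J3E g Phi gam : J3 g Phi gam = fun t => 3%:R / 2%:R * antisym (contr3 g Phi gam) t.
Proof. by []. Qed.

Lemma J3_pullback A g Phi gam : A \in unitmx -> metric_mx g \in unitmx ->
  J3 (pullback A g) (pullback A Phi) (pullback A gam) =
  pullback A (J3 g Phi gam).
Proof.
by move=> uA uG; rewrite !J3E contr3_pullback // pullbackZ pullback_antisym.
Qed.

Lemma torsion5_pullback A g Phi T : A \in unitmx -> metric_mx g \in unitmx ->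
  (metric_mx g)^T = metric_mx g -> is_alternating Phi ->
  torsion5 (pullback A g) (pullback A Phi) (pullback A T) =
  pullback A (torsion5 g Phi T).
Proof.
move=> uA uG sym_g alt_Phi; rewrite !torsion5E //; last 2 first.
- by rewrite metric_pullback !trmx_mul trmxK sym_g mulmxA.
- exact: pullback_alt.
rewrite contr_pullback inv_metric_pullback //.
have N1 (w : ctensor R 8 5) : (fun u => - w u) = fun u => -1 * w u.
  by apply/funext => u; rewrite mulN1r.
by rewrite !N1 pullbackZ.
Qed.

Lemma hodge5_pullback A g eps (w : ctensor R 8 5) :
  A \in unitmx -> metric_mx g \in unitmx ->
  hodge5 (pullback A g) (pullback A eps) (pullback A w) =
  pullback A (hodge5 g eps w).
Proof.
move=> uA uG; rewrite !hodge5E contr_pullback pullbackZ.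
by rewrite -(inv_metric_pullback uA uG) !trmx_mul trmxK mulmxA.
Qed.

Lemma J3_alt g Phi gam : is_alternating (J3 g Phi gam).
Proof. by move=> s t; rewrite J3E antisym_alt mulrCA. Qed.

(** The contraction is antisymmetric in its first two slots, so its cyclic sum [H] is already
    alternating and equals its own antisymmetrisation. Since 3-cycles are even, the three rotated
    terms antisymmetrise to the same tensor, whence the factor 3. *)
Lemma J3_cyclic g Phi gam i j k : is_alternating Phi ->
  J3 g Phi gam [tuple i; j; k] =
  2%:R^-1 * (Phi_contr g Phi gam i j k + Phi_contr g Phi gam j k i
             + Phi_contr g Phi gam k i j).
Proof.
move=> alt_Phi.
have raise_swap a b p q : raise34 g Phi b a p q = - raise34 g Phi a b p q.
  rewrite /raise34 -sumrN; apply: eq_bigr => r _; rewrite -sumrN.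
  apply: eq_bigr => s _; rewrite -mulrN; congr (_ * _).
  exact: alt4_swap12.
have swap a b c : Phi_contr g Phi gam b a c = - Phi_contr g Phi gam a b c.
  rewrite /Phi_contr -sumrN; apply: eq_bigr => p _; rewrite -sumrN.
  by apply: eq_bigr => q _; rewrite raise_swap mulNr.
pose c1 : 'S_3 := (tperm (inord 0) (inord 1) * tperm (inord 1) (inord 2))%g.
have c1E (a b c : 'I_8) : permute_tuple c1 [tuple a; b; c] = [tuple c; a; b].
  apply: eq_from_tnth => m; rewrite tnth_mktuple permM !tnth_tuple3.
  have : m = inord m by rewrite inord_val.
  have := ltn_ord m; case: (val m) => [|[|[|]]] //= _ ->.
  - by rewrite tpermL tpermL -!val_eqE /= !inordK.
  - by rewrite tpermR tpermD -!val_eqE /= !inordK.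
  - by rewrite [tperm (inord 0) _ _]tpermD ?tpermR -!val_eqE /= !inordK.
pose H := fun u : 3.-tuple 'I_8 => contr3 g Phi gam u +
  contr3 g Phi gam (permute_tuple c1 u) + contr3 g Phi gam (permute_tuple (c1 * c1)%g u).
have HE a b c : H [tuple a; b; c] = Phi_contr g Phi gam a b c +
    Phi_contr g Phi gam c a b + Phi_contr g Phi gam b c a.
  rewrite /H -permute_tupleM !c1E /contr3 !tnth_tuple3 -!val_eqE /= !inordK //=.
have alt_H : is_alternating H.
  apply: is_alternating3 => a b c; rewrite !HE.
    rewrite [in LHS]swap (swap a c b) (swap c b a); ring.
  rewrite [in LHS](swap c a b) (swap b a c) (swap b c a); ring.
have even_c1 : odd_perm c1 = false.
  by rewrite odd_permM !odd_tperm -!val_eqE /= !inordK.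
have : H [tuple i; j; k] = 3%:R * antisym (contr3 g Phi gam) [tuple i; j; k].
  rewrite -[H in LHS]antisym_id // !antisymD !antisym_permute odd_permM even_c1 /=.
  ring.
rewrite HE J3E => h.
have {}h : antisym (contr3 g Phi gam) [tuple i; j; k] =
    3%:R^-1 * (Phi_contr g Phi gam i j k +
    Phi_contr g Phi gam k i j + Phi_contr g Phi gam j k i) by rewrite h; field.
by rewrite h; field.
Qed.

End Equivariance.

(** * Signs of index sequences *)

(* The sign of the permutation sorting [s], or 0 if [s] has a repetition. It is
   the sign of the Vandermonde determinant of [s], hence alternating. *)
Fixpoint seq_sign (s : seq nat) : int :=
  if s is x :: s' then
    foldr (fun y e => if y == x then 0 else if (x < y)%N then e else - e)
          (seq_sign s') s'
  else 1.

Lemma seq_sign_cons x s : seq_sign (x :: s) =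
  (\prod_(y <- s) sgz (y%:Z - x%:Z)) * seq_sign s.
Proof.
rewrite /=; move: (seq_sign s) => e; elim: s => [|y s IH] /=.
  by rewrite big_nil mul1r.
rewrite big_cons IH; case: eqP => [->|/eqP neq_yx]; first by rewrite subrr sgz0 !mul0r.
case: ltnP => [lt_xy|le_yx].
  by rewrite gtr0_sgz ?mul1r // subr_gt0 ltz_nat.
by rewrite ltr0_sgz ?mulN1r ?mulNr // subr_lt0 ltz_nat ltn_neqAle neq_yx.
Qed.

Lemma seq_sign_not_uniq s : ~~ uniq s -> seq_sign s = 0.
Proof.
elim: s => [|x s IH] //; rewrite seq_sign_cons /= negb_and negbK.
case/orP => [x_s|/IH ->]; last by rewrite mulr0.
by rewrite (big_rem x) //= subrr sgz0 !mul0r.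
Qed.

Lemma seq_sign_sorted s : sorted ltn s -> seq_sign s = 1.
Proof.
elim: s => [|x s IH] // srt; rewrite seq_sign_cons IH; last exact: path_sorted srt.
rewrite mulr1 big_seq big1 // => y y_s; apply: gtr0_sgz.
rewrite subr_gt0 ltz_nat; move: srt; rewrite /= path_sortedE; last exact: ltn_trans.
by case/andP => /allP /(_ y y_s).
Qed.

(** * Alternating tensors and their values on increasing index tuples *)

Section Sorted.
Variables (R : realType) (n : nat).
Implicit Types (k : nat).

Definition vals k (t : k.-tuple 'I_n) : seq nat := map val t.

Lemma seq_sign_Vandermonde k (t : k.-tuple 'I_n) :
  seq_sign (vals t) = sgz (\det (Vandermonde k (\row_m (tnth t m : nat)%:Z))).
Proof.
rewrite det_Vandermonde.
transitivity (\prod_(i < k) \prod_(j < k | (i < j)%N)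
   sgz ((tnth t j : nat)%:Z - (tnth t i : nat)%:Z)); last first.
  have sgz_prod := big_morph (@sgz int) (@sgzM int) (@sgz1 int).
  rewrite sgz_prod; apply: eq_bigr => i _.
  by rewrite sgz_prod; apply: eq_bigr => j _; rewrite !mxE.
elim: k t => [|k IH] t; first by rewrite big_ord0 [t]tuple0.
case/tupleP: t => x t; rewrite [vals _]/= seq_sign_cons -/(vals t) IH.
rewrite big_ord_recl /=; congr (_ * _).
  rewrite big_map big_tuple [RHS]big_mkcond big_ord_recl /= mul1r.
  by apply: eq_bigr => j _; rewrite tnthS.
apply: eq_bigr => i _; rewrite [RHS]big_mkcond big_ord_recl /= mul1r [LHS]big_mkcond.
by apply: eq_bigr => j _; rewrite !tnthS.
Qed.

Lemma seq_sign_permute k s (t : k.-tuple 'I_n) :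
  seq_sign (vals (permute_tuple s t)) = (-1) ^+ s * seq_sign (vals t).
Proof.
rewrite !seq_sign_Vandermonde.
have -> : Vandermonde k (\row_m (tnth (permute_tuple s t) m : nat)%:Z) =
    col_perm s (Vandermonde k (\row_m (tnth t m : nat)%:Z)).
  by apply/matrixP => i j; rewrite !mxE tnth_mktuple.
rewrite col_permE det_mulmx det_perm odd_permV sgzM mulrC; congr (_ * _).
by case: (odd_perm s); rewrite ?expr0 ?expr1 ?sgzN ?sgz1.
Qed.

Lemma alt_not_uniq k (w : ctensor R n k) (t : k.-tuple 'I_n) :
  is_alternating w -> ~~ uniq t -> w t = 0.
Proof.
move=> alt_w /tuple_uniqP not_inj.
have [i [j [neq_ij tij]]] : exists i j, i != j /\ tnth t i = tnth t j.
  apply: contrapT => h; apply: not_inj => i j eq_tij.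
  by apply/eqP/negPn/negP => neq_ij; apply: h; exists i, j.
suff : w t = - w t by lra.
exact: (alt_swap alt_w neq_ij).
Qed.

Lemma sort_permute k (t : k.-tuple 'I_n) :
  exists s : 'S_k, vals (permute_tuple s t) = sort leq (vals t).
Proof.
have /tuple_permP[s es] : perm_eq (sort (relpre val leq) t) t by rewrite perm_sort.
by exists s; rewrite /vals sort_map es.
Qed.

Lemma vals_uniq k (t : k.-tuple 'I_n) : uniq (vals t) = uniq t.
Proof. by rewrite map_inj_uniq //; exact: val_inj. Qed.

(** On a repeated index both tensors vanish; otherwise a sorting permutation multiplies both by the
    same invertible sign. *)
Lemma alt_sorted k (w w' : ctensor R n k) :
  is_alternating w -> is_alternating w' ->
  (forall t, sorted ltn (vals t) -> w t = w' t) -> w = w'.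
Proof.
move=> alt_w alt_w' eq_w; apply/funext => t.
have [uniq_t|nuniq_t] := boolP (uniq t); last by rewrite !alt_not_uniq.
have [s srt] := sort_permute t.
have : w (permute_tuple s t) = w' (permute_tuple s t).
  apply: eq_w; rewrite srt ltn_sorted_uniq_leq sort_uniq vals_uniq uniq_t.
  exact: sort_sorted leq_total _.
by rewrite alt_w alt_w' => /(mulrI _); apply; rewrite unitrX ?unitrN1.
Qed.

(** The alternating extension of values prescribed on increasing sequences. The test for 0 spares
    the sorting and the call of [f] on words with a repetition during [vm_compute]. *)
Definition alt_ext (f : seq nat -> int) (s : seq nat) : int :=
  let e := seq_sign s in if e == 0 then 0 else e * f (sort leq s).

Lemma alt_extE f s : alt_ext f s = seq_sign s * f (sort leq s).
Proof. by rewrite /alt_ext; case: eqP => // ->; rewrite mul0r. Qed.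

Lemma alt_ext_alt k f :
  is_alternating (fun t : k.-tuple 'I_n => (alt_ext f (vals t))%:~R : R).
Proof.
move=> s t; rewrite !alt_extE seq_sign_permute.
have -> : sort leq (vals (permute_tuple s t)) = sort leq (vals t).
  apply/(perm_sortP leq_total leq_trans anti_leq); apply: perm_map.
  by apply/tuple_permP; exists s.
rewrite -mulrA intrM; congr (_ * _).
by case: (odd_perm s); rewrite ?expr0 ?expr1 ?rmorphN.
Qed.

Lemma alt_eq_ext k (w : ctensor R n k) f : is_alternating w ->
  (forall t, sorted ltn (vals t) -> w t = (f (vals t))%:~R) ->
  forall t, w t = (alt_ext f (vals t))%:~R.
Proof.
move=> alt_w wf t; pose w' : ctensor R n k := fun t => (alt_ext f (vals t))%:~R.
suff -> : w = w' by [].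
apply: alt_sorted => //; first exact: alt_ext_alt.
move=> {}t srt; rewrite wf // /w' alt_extE seq_sign_sorted //.
rewrite mul1r (sorted_sort leq_trans) //.
by move: srt; rewrite ltn_sorted_uniq_leq => /andP[].
Qed.

Lemma dx_alt k (q : k.-tuple 'I_n) : is_alternating (dx R q).
Proof.
move=> s t; rewrite /dx.
have -> : (\matrix_(a, b) (tnth q a == tnth (permute_tuple s t) b)%:R) =
    col_perm s (\matrix_(a, b) (tnth q a == tnth t b)%:R) :> 'M[R]_k.
  by apply/matrixP => i j; rewrite !mxE tnth_mktuple.
by rewrite col_permE det_mulmx det_perm odd_permV mulrC.
Qed.

(** A nonzero term of the Leibniz expansion would make [q] a permutation of [t], and increasing
    sequences with the same entries coincide. *)
Lemma dx_sorted k (q t : k.-tuple 'I_n) :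
  sorted ltn (vals q) -> sorted ltn (vals t) ->
  dx R q t = (vals q == vals t)%:R.
Proof.
move=> srt_q srt_t; have uniq_t : uniq t.
  by rewrite -vals_uniq (sorted_uniq ltn_trans ltnn).
have [/(inj_map val_inj)/val_inj ->|/eqP neq_qt] := eqVneq (vals q) (vals t).
  rewrite /dx (_ : \matrix_(a, b) _ = 1%:M) ?det1 //.
  apply/matrixP => i j; rewrite !mxE; congr (_%:R).
  by rewrite (inj_eq (tuple_uniqP _ uniq_t)).
rewrite /dx /determinant big1 // => s _.
apply/eqP; rewrite mulf_eq0; apply/orP; right.
apply/contraT => /prodf_neq0 h; case: neq_qt.
have e : q = permute_tuple s t.
  apply: eq_from_tnth => m; rewrite tnth_mktuple; have := h m isT; rewrite mxE.
  by case: (tnth q m =P _) => //; rewrite eqxx.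
apply: (irr_sorted_eq ltn_trans ltnn) => // x.
by apply: perm_mem; apply: perm_map; apply/tuple_permP; exists s; rewrite e.
Qed.

End Sorted.

(** * Formal linear forms on alternating 3-tensors *)

(* [Phi0_sorted] lists the components of [Phi0] on increasing index sequences,
   numbered from 0. *)
Definition Phi0_sorted (s : seq nat) : int :=
  - ((s == [:: 0; 1; 2; 3]%N)%:Z + (s == [:: 0; 1; 4; 5]%N)%:Z
     + (s == [:: 0; 1; 6; 7]%N)%:Z + (s == [:: 0; 2; 4; 6]%N)%:Z
     - (s == [:: 0; 2; 5; 7]%N)%:Z - (s == [:: 0; 3; 4; 7]%N)%:Z
     - (s == [:: 0; 3; 5; 6]%N)%:Z - (s == [:: 1; 2; 4; 7]%N)%:Z
     - (s == [:: 1; 2; 5; 6]%N)%:Z - (s == [:: 1; 3; 4; 6]%N)%:Z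
     + (s == [:: 1; 3; 5; 7]%N)%:Z + (s == [:: 2; 3; 4; 5]%N)%:Z
     + (s == [:: 2; 3; 6; 7]%N)%:Z + (s == [:: 4; 5; 6; 7]%N)%:Z).

Definition Phi0_seq := alt_ext Phi0_sorted.

(* A list of pairs [(c, s)] stands for the functional
   [gam |-> \sum c * gam s]; see [lin_eval] below. *)
Definition lin_form := seq (int * seq nat).

Definition lin_scale (c : int) (l : lin_form) : lin_form :=
  [seq (c * x.1, x.2) | x <- l].

Definition lin_norm (l : lin_form) : lin_form :=
  [seq (x.1 * seq_sign x.2, sort leq x.2) | x <- l & seq_sign x.2 != 0].

Definition lin_coef (l : lin_form) (q : seq nat) : int :=
  foldr (fun x acc => if x.2 == q then x.1 + acc else acc) 0 l.

(** A sufficient test for vanishing on all alternating tensors: after normalisation the coefficients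
    of each index word that occurs must cancel. *)
Definition lin_zero (l : lin_form) : bool :=
  let l' := lin_norm l in
  all (fun q => lin_coef l' q == 0) (undup [seq x.2 | x <- l']).

Definition lin_comp (l : lin_form) (f : seq nat -> lin_form) : lin_form :=
  flatten [seq lin_scale x.1 (f x.2) | x <- l].

(** For distinct [i] and [j] below 8 only six of the 64 coefficients are nonzero; discarding the
    others keeps composites short. *)
Definition contr_lin (i j k : nat) : lin_form :=
  [seq x <- [seq (Phi0_seq [:: i; j; p; q], [:: k; p; q])
              | p <- iota 0 8, q <- iota 0 8] | x.1 != 0].

(* The functional [gam |-> 2 * J3 gam s] for the Euclidean Cayley form. *)
Definition J3_lin (s : seq nat) : lin_form :=
  let i := nth 0%N s 0 in let j := nth 0%N s 1 in let k := nth 0%N s 2 in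
  contr_lin i j k ++ contr_lin j k i ++ contr_lin k i j.

(** Only words without repetition that avoid [s] are generated: for an increasing triple and
    [k = 5], 120 words instead of 32768. *)
Fixpoint arrangements k (s : seq nat) : seq (seq nat) :=
  if k is k'.+1 then
    flatten [seq [seq a :: u | u <- arrangements k' (a :: s)]
              | a <- iota 0 8 & a \notin s]
  else [:: [::]].

(** With [u] read as i, a, b, c, d, this is the term T_{ia}^p Phi_{pbcd} weighted by the volume
    form; [drop 2 u] is the part b, c, d, and the Euclidean metric raises indices trivially. *)
Definition hodge_terms (s u : seq nat) : lin_form :=
  let e := seq_sign (s ++ u) in
  [seq x <- [seq (e * Phi0_seq (p :: drop 2 u), [:: nth 0%N u 0; nth 0%N u 1; p])
              | p <- iota 0 8] | x.1 != 0].

(* The functional [T |-> \sum_u vol0 (s ++ u) * torsion5 g0 Phi0 T u]; words [u]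
   with a repetition in [s ++ u] do not contribute. *)
Definition hodge_lin (s : seq nat) : lin_form :=
  flatten [seq hodge_terms s u | u <- arrangements 5 s].

Fixpoint words k : seq (seq nat) :=
  if k is k'.+1 then [seq a :: u | a <- iota 0 8, u <- words k'] else [:: [::]].

Definition triples : seq (seq nat) := [seq s <- words 3 | sorted ltn s].

Arguments seq_sign : simpl never.
Arguments alt_ext : simpl never.
Arguments Phi0_seq : simpl never.
Arguments contr_lin : simpl never.
Arguments J3_lin : simpl never.
Arguments hodge_terms : simpl never.
Arguments hodge_lin : simpl never.
Arguments words : simpl never.
Arguments arrangements : simpl never.

(* [4 J3^2 + 20 J3 - 24 = 0], in terms of the functionals for [2 J3]. *)
Lemma J3_lin_check : all (fun t => lin_zero
  (lin_comp (J3_lin t) J3_lin ++ lin_scale 10 (J3_lin t) ++ [:: (-24, t)])) triples.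
Proof. by vm_compute. Qed.

(** The star of 20 times the antisymmetrised contraction is 20 / 5! = 1/6 of the sum encoded by
    [hodge_lin]. That sum must thus be 6 times [2 J3], and [J3_lin] encodes [2 J3]. *)
Lemma hodge_lin_check :
  all (fun t => lin_zero (hodge_lin t ++ lin_scale (-6) (J3_lin t))) triples.
Proof. by vm_compute. Qed.

Lemma J3_lin_zero s : s \in triples ->
  lin_zero (lin_comp (J3_lin s) J3_lin ++ lin_scale 10 (J3_lin s) ++ [:: (-24, s)]).
Proof. by move=> s3; have := allP J3_lin_check; move=> /(_ s); apply. Qed.

Lemma hodge_lin_zero s : s \in triples ->
  lin_zero (hodge_lin s ++ lin_scale (-6) (J3_lin s)).
Proof. by move=> s3; have := allP hodge_lin_check; move=> /(_ s); apply. Qed.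

(** * Soundness of the integer model and the quadratic relation for the Euclidean [J3] *)

Section Standard.
Variable R : realType.

Lemma vals_lt8 k (t : k.-tuple 'I_8) : all (ltn^~ 8) (vals t).
Proof. by apply/allP => _ /mapP[i _ ->]; exact: ltn_ord. Qed.

Lemma Phi0_alt : is_alternating (@Phi0 R).
Proof.
by move=> s t; rewrite /Phi0 /dx4 !dx_alt !(mulrN, mulrDr).
Qed.

Lemma vals_ix4 i j k l :
  vals [tuple ix i; ix j; ix k; ix l] =
  [:: (ix i : nat); (ix j : nat); (ix k : nat); (ix l : nat)].
Proof. by []. Qed.

(** Both sides are alternating, and on an increasing tuple each determinant in [Phi0] becomes an
    indicator. The predecessors pass from coordinates numbered from 1 to indices numbered from 0. *)
Lemma Phi0E t : @Phi0 R t = (Phi0_seq (vals t))%:~R.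
Proof.
apply: alt_eq_ext => {t}; first exact: Phi0_alt.
move=> t srt.
have dx4E i j k l : (0 < i < j)%N -> (j < k < l)%N -> (l < 9)%N ->
    dx4 R i j k l t = ((vals t == [:: i.-1; j.-1; k.-1; l.-1])%N%:Z)%:~R.
  move=> hij hkl hl.
  have e : vals [tuple ix i; ix j; ix k; ix l] = [:: i.-1; j.-1; k.-1; l.-1].
    by rewrite vals_ix4 /ix !inordK //; lia.
  rewrite /dx4 dx_sorted // ?e 1?eq_sym //.
  by rewrite /= !andbT; lia.
rewrite /Phi0 !dx4E // /Phi0_sorted.
by rewrite !(rmorphN, rmorphD).
Qed.

(** Eight distinct indices below 8 exhaust them, so the only increasing 8-tuple is the identity,
    where both sides are 1. *)
Lemma vol0E t : vol0 R t = (seq_sign (vals t))%:~R.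
Proof.
have -> : seq_sign (vals t) = alt_ext (fun=> 1) (vals t) by rewrite alt_extE mulr1.
apply: (alt_eq_ext (w := vol0 R)) => {t}; first exact: dx_alt.
have sorted_id : sorted ltn (vals [tuple i | i < 8]).
  by rewrite /vals /= map_id val_enum_ord.
move=> t srt; rewrite /vol0 dx_sorted //.
suff -> : vals [tuple i | i < 8] = vals t by rewrite eqxx.
have uniq_srt s : sorted ltn s -> uniq s by exact: (sorted_uniq ltn_trans ltnn).
have vid : vals [tuple i | i < 8] = iota 0 8 by rewrite /vals /= map_id val_enum_ord.
rewrite vid; apply: (irr_sorted_eq ltn_trans ltnn) => // x.
have sub : {subset vals t <= iota 0 8}.
  by move=> y /(allP (vals_lt8 t)); rewrite mem_iota.
have le8 : (size (iota 0 8) <= size (vals t))%N by rewrite size_iota size_map size_tuple.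
by case: (uniq_min_size (uniq_srt _ srt) sub le8) => _ ->.
Qed.

(* Entries of [s] that are missing or not less than 8 are read as the index 0. *)
Definition at_seq k (w : ctensor R 8 k) (s : seq nat) : R :=
  w [tuple inord (nth 0%N s m) | m < k].

Lemma at_seq_vals k (w : ctensor R 8 k) t : at_seq w (vals t) = w t.
Proof.
congr w; apply: eq_from_tnth => m; rewrite tnth_mktuple.
by rewrite /vals (nth_map (tnth t m)) ?size_tuple // -tnth_nth inord_val.
Qed.

Definition lin_eval (w : ctensor R 8 3) (l : lin_form) : R :=
  \sum_(x <- l) x.1%:~R * at_seq w x.2.

Lemma lin_eval_cat w l l' : lin_eval w (l ++ l') = lin_eval w l + lin_eval w l'.
Proof. exact: big_cat. Qed.

Lemma lin_eval_scale w c l : lin_eval w (lin_scale c l) = c%:~R * lin_eval w l.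
Proof.
rewrite /lin_eval big_map mulr_sumr; apply: eq_bigr => x _.
by rewrite intrM mulrA.
Qed.

Lemma lin_eval_flatten w ls : lin_eval w (flatten ls) = \sum_(l <- ls) lin_eval w l.
Proof. by rewrite /lin_eval big_flatten. Qed.

Lemma lin_eval_nonzero w (l : lin_form) :
  lin_eval w [seq x <- l | x.1 != 0] = lin_eval w l.
Proof.
rewrite /lin_eval big_filter big_mkcond /=; apply: eq_bigr => x _.
by case: eqP => // ->; rewrite mul0r.
Qed.

Definition in_range : pred (seq nat) :=
  [pred s : seq nat | (size s == 3%N) && all (ltn^~ 8) s].

Lemma in_range_vals (t : 3.-tuple 'I_8) : in_range (vals t).
Proof. by rewrite /in_range /= size_map size_tuple vals_lt8. Qed.

Lemma in_rangeP s : in_range s -> exists t : 3.-tuple 'I_8, s = vals t.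
Proof.
case/andP => /eqP sz lt8.
exists [tuple inord (nth 0%N s m) | m < 3].
apply: (@eq_from_nth _ 0%N); first by rewrite size_map size_tuple.
rewrite sz => m lt_m3; rewrite (nth_map (inord 0)) ?size_tuple //.
rewrite -[m]/(val (Ordinal lt_m3)) -tnth_nth tnth_mktuple /= inordK //.
by apply: (allP lt8 (nth 0%N s m)); rewrite mem_nth // sz.
Qed.

Lemma at_seq_sort (w : ctensor R 8 3) s : is_alternating w -> in_range s ->
  at_seq w s = (seq_sign s)%:~R * at_seq w (sort leq s).
Proof.
move=> alt_w /in_rangeP[t ->]; rewrite at_seq_vals.
have [uniq_t|nuniq_t] := boolP (uniq t); last first.
  by rewrite alt_not_uniq // seq_sign_not_uniq ?vals_uniq // mul0r.
have [p srt] := sort_permute t.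
rewrite -srt at_seq_vals alt_w mulrA.
have : seq_sign (vals (permute_tuple p t)) = 1.
  rewrite srt; apply: seq_sign_sorted; rewrite ltn_sorted_uniq_leq sort_uniq.
  by rewrite vals_uniq uniq_t sort_sorted //; exact: leq_total.
rewrite seq_sign_permute => /(congr1 (intr : int -> R)).
rewrite intrM mulrC; case: (odd_perm p); rewrite ?expr0 ?expr1 => ->;
 by rewrite mul1r.
Qed.

(** Alternation of [w] makes [lin_norm] harmless, and grouping terms by index word turns the value
    into a combination of the coefficients [lin_coef]. The range condition matters because [at_seq]
    reads an entry outside the range as 0, which sorting would not respect. *)
Lemma lin_zeroP w l : is_alternating w -> all (fun x => in_range x.2) l ->
  lin_zero l -> lin_eval w l = 0.
Proof.
move=> alt_w range_l zero_l.
have -> : lin_eval w l = lin_eval w (lin_norm l).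
  rewrite /lin_eval big_map big_filter [RHS]big_mkcond !big_seq; apply: eq_bigr => x x_l.
  rewrite at_seq_sort //; last exact: (allP range_l).
  by case: eqP => [->|_]; rewrite ?mul0r ?mulr0 // intrM mulrA.
move: zero_l; rewrite /lin_zero; set l' := lin_norm l => /allP zero_l'.
pose Q := undup [seq x.2 | x <- l'].
transitivity (\sum_(x <- l') \sum_(q <- Q | x.2 == q) x.1%:~R * at_seq w q).
  rewrite /lin_eval !big_seq; apply: eq_bigr => x x_l'.
  rewrite big_mkcond (bigD1_seq x.2) ?undup_uniq ?mem_undup ?map_f //= eqxx.
  by rewrite big1 ?addr0 // => q; rewrite eq_sym => /negPf ->.
rewrite (exchange_big_dep xpredT) //= big_seq big1 // => q q_Q.
rewrite -mulr_suml -rmorph_sum /=.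
suff -> : \sum_(x <- l' | x.2 == q) x.1 = lin_coef l' q.
  by rewrite (eqP (zero_l' q q_Q)) mul0r.
(* Unlocked, the big sum is the very [foldr] that defines [lin_coef]. *)
by rewrite unlock.
Qed.

Lemma sum_iota n (V : nmodType) (F : nat -> V) :
  \sum_(i <- iota 0 n) F i = \sum_(i < n) F i.
Proof. by rewrite -(big_mkord xpredT) /index_iota subn0. Qed.

Lemma sum_words (V : nmodType) k (F : seq nat -> V) :
  \sum_(s <- words k) F s = \sum_(u : k.-tuple 'I_8) F (vals u).
Proof.
elim: k F => [|k IH] F; first by rewrite big_seq1 sum_tuple0.
rewrite big_allpairs_dep sum_tuple_cons sum_iota; apply: eq_bigr => i _.
exact: (IH (fun s => F (val i :: s))).
Qed.

(** After the letter [a], a further [a] is a repetition; hence the induction passes to [a :: s]. *)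
Lemma sum_arrangements (V : nmodType) k s (F : seq nat -> V) :
  (forall u, has (mem s) u || ~~ uniq u -> F u = 0) ->
  \sum_(u <- arrangements k s) F u = \sum_(u <- words k) F u.
Proof.
elim: k s F => [|k IH] s F F0 //.
rewrite {1}/arrangements -/arrangements {1}/words -/words big_flatten big_map big_filter.
rewrite big_allpairs_dep [LHS]big_mkcond; apply: eq_bigr => a _.
case: ifPn => [a_s|]; last first.
  rewrite negbK => a_s; rewrite big1 // => u _; apply: F0.
  by rewrite /= a_s.
rewrite big_map IH // => u /orP[|not_uniq_u]; last first.
  by apply: F0; rewrite /= negb_and not_uniq_u !orbT.
case/hasP => b b_u; rewrite !inE => /orP[/eqP eq_ba|b_s]; apply: F0.
  by rewrite /= -eq_ba b_u orbT.
by apply/orP; left => /=; apply/orP; right; apply/hasP; exists b.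
Qed.

Lemma metric_g0 : metric_mx (@g0 R) = 1%:M.
Proof. by apply/matrixP => i j; rewrite !mxE /g0. Qed.

Lemma inv_metric_g0 i j : inv_metric (@g0 R) i j = (i == j)%:R.
Proof. by rewrite /inv_metric metric_g0 invmx1 mxE. Qed.

Lemma sum_delta (I : finType) (i : I) (F : I -> R) :
  \sum_j (i == j)%:R * F j = F i.
Proof.
rewrite (bigD1 i) //= eqxx mul1r big1 ?addr0 // => j.
by rewrite eq_sym => /negPf ->; rewrite mul0r.
Qed.

Lemma raise_g0 k (w : ctensor R 8 k) : raise (@g0 R) w = w.
Proof.
rewrite -[RHS]pullback1; apply/funext => u; apply: eq_bigr => v _.
congr (_ * _); rewrite /kron; apply: eq_bigr => m _.
by rewrite inv_metric_g0 mxE eq_sym.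
Qed.

Lemma raise34_g0 (i j p q : 'I_8) :
  raise34 (@g0 R) (@Phi0 R) i j p q = Phi0 R [tuple i; j; p; q].
Proof.
rewrite /raise34.
under eq_bigr => r _ do under eq_bigr => s _ do
  rewrite !inv_metric_g0 -mulrA.
under eq_bigr => r _ do rewrite -mulr_sumr sum_delta.
by rewrite sum_delta.
Qed.

Lemma Phi_contr_g0 (gam : ctensor R 8 3) (i j k : 'I_8) :
  Phi_contr (@g0 R) (@Phi0 R) gam i j k = lin_eval gam (contr_lin i j k).
Proof.
rewrite lin_eval_nonzero /lin_eval big_allpairs_dep sum_iota; apply: eq_bigr => p _.
rewrite sum_iota; apply: eq_bigr => q _ /=.
rewrite raise34_g0 Phi0E -(at_seq_vals gam).
by [].
Qed.

Lemma contr_lin_range i j k : (k < 8)%N -> all (fun x => in_range x.2) (contr_lin i j k).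
Proof.
move=> lt_k8; apply/allP => x; rewrite mem_filter => /andP[_].
case/allpairsP => -[p q] [].
rewrite !mem_iota => p8 q8 ->; rewrite /in_range /=; exact/and4P.
Qed.

Lemma J3_linE i j k :
  J3_lin [:: i; j; k] = contr_lin i j k ++ contr_lin j k i ++ contr_lin k i j.
Proof. by []. Qed.

Opaque contr_lin J3_lin.

(** The factor 2 clears the denominator of the cyclic formula and keeps all coefficients
    integral. *)
Lemma J3_lin_eval (gam : ctensor R 8 3) t : 
  2%:R * J3 (@g0 R) (@Phi0 R) gam t = lin_eval gam (J3_lin (vals t)).
Proof.
have [i [j [k ->]]] := tuple3P t.
rewrite J3_cyclic; last exact: Phi0_alt.
rewrite mulrA mulfV ?pnatr_eq0 // mul1r !Phi_contr_g0.
by rewrite [J3_lin _]J3_linE 2!lin_eval_cat addrA.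
Qed.

Lemma J3_lin_range s : in_range s -> all (fun x => in_range x.2) (J3_lin s).
Proof.
case/in_rangeP => t ->; have [i [j [k ->]]] := tuple3P t.
by rewrite [J3_lin _]J3_linE 2!all_cat !contr_lin_range ?ltn_ord.
Qed.

Lemma lin_scale_range c l :
  all (fun x => in_range x.2) (lin_scale c l) = all (fun x => in_range x.2) l.
Proof. by rewrite all_map. Qed.

Lemma mem_words k (u : k.-tuple 'I_8) : vals u \in words k.
Proof.
elim: k u => [|k IH] u; first by rewrite [u]tuple0.
case/tupleP: u => x u; apply/allpairsP; exists (val x, vals u).
by split; [rewrite mem_iota ltn_ord | exact: IH | by []].
Qed.

Lemma mem_triples (t : 3.-tuple 'I_8) : sorted ltn (vals t) -> vals t \in triples.
Proof. by move=> srt; rewrite mem_filter srt mem_words. Qed.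

Lemma lin_comp_range l f : all (fun x => in_range x.2) l ->
  (forall s, in_range s -> all (fun x => in_range x.2) (f s)) ->
  all (fun x => in_range x.2) (lin_comp l f).
Proof.
move=> range_l range_f; apply/allP => x /flatten_mapP[y y_l]; move: x.
by apply/allP; rewrite lin_scale_range range_f //; exact: (allP range_l y).
Qed.

Lemma lin_eval_comp w w' c l f : all (fun x => in_range x.2) l ->
  (forall t : 3.-tuple 'I_8, c * w' t = lin_eval w (f (vals t))) ->
  lin_eval w (lin_comp l f) = c * lin_eval w' l.
Proof.
move=> range_l w'E; rewrite /lin_comp lin_eval_flatten big_map /lin_eval mulr_sumr.
rewrite !big_seq; apply: eq_bigr => y y_l; rewrite -/(lin_eval _ _) lin_eval_scale.
have /in_rangeP[u ->] := allP range_l y y_l.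
by rewrite at_seq_vals mulrCA w'E.
Qed.

Opaque lin_comp lin_scale lin_zero hodge_lin.

(** The eigenvalue -6 belongs to the 8-dimensional space of contractions of [Phi0] with a vector,
    the eigenvalue 1 to its 48-dimensional orthogonal complement. *)
Lemma J3_quadratic (gam : ctensor R 8 3) : is_alternating gam ->
  J3 (@g0 R) (@Phi0 R) (J3 (@g0 R) (@Phi0 R) gam) =
  fun t => 6%:R * gam t - 5%:R * J3 (@g0 R) (@Phi0 R) gam t.
Proof.
move=> alt_gam; set J := J3 _ _.
apply: alt_sorted; first exact: J3_alt.
  move=> s t; rewrite alt_gam /J J3_alt [RHS]mulrBr; congr (_ - _); exact: mulrCA.
move=> t srt; have zero := J3_lin_zero (mem_triples srt).
have rt := in_range_vals t; have rJ := J3_lin_range rt.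
have := lin_zeroP alt_gam _ zero.
rewrite 2!all_cat lin_scale_range rJ lin_comp_range //; last exact: J3_lin_range.
rewrite all_seq1 /= rt => /(_ isT).
rewrite 2!lin_eval_cat lin_eval_scale {3}/lin_eval big_seq1 /= at_seq_vals.
rewrite (lin_eval_comp rJ (fun t => J3_lin_eval gam t)) -!J3_lin_eval -/J.
move: (gam t) (J gam t) (J (J gam) t) => x y z; lra.
Qed.

End Standard.

(** * The Hodge star of the torsion contraction in the Euclidean model *)

Section Standard.
Variable R : realType.

(** Reindexing the sum moves each permutation from [h] to [f], where its sign cancels. *)
Lemma sum_alt_antisym k n (f h : ctensor R n k) : is_alternating f ->
  \sum_u f u * antisym h u = \sum_u f u * h u.
Proof.
move=> alt_f; rewrite /antisym.
under eq_bigr do rewrite mulrCA mulr_sumr.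
rewrite -mulr_sumr exchange_big /=.
transitivity ((k`!)%:R^-1 * \sum_(s : 'S_k) \sum_u f u * h u).
  congr (_ * _); apply: eq_bigr => s _.
  rewrite [RHS](reindex (permute_tuple s)) /=; last first.
    exact/onW_bij/permute_tuple_bij.
  by apply: eq_bigr => u _; rewrite alt_f -mulrA mulrCA.
move: (\sum_u f u * h u) => x.
by rewrite sumr_const card_Sn -[X in _ * X]mulr_natl mulrA mulVf ?mul1r ?fact_neq0.
Qed.

(** The mixed product depends only on the two multisets of entries, so permuting one block changes
    the sign only through that block. *)
Lemma seq_sign_cat s s' : seq_sign (s ++ s') =
  seq_sign s * (\prod_(x <- s) \prod_(y <- s') sgz (y%:Z - x%:Z)) * seq_sign s'.
Proof.
elim: s => [|x s IH]; first by rewrite big_nil !mul1r.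
by rewrite cat_cons !seq_sign_cons IH big_cat big_cons /=; ring.
Qed.

Lemma perm_vals k n (s : 'S_k) (t : k.-tuple 'I_n) :
  perm_eq (vals (permute_tuple s t)) (vals t).
Proof. by apply: perm_map; apply/tuple_permP; exists s. Qed.

Lemma seq_sign_catl k n (s : 'S_k) (t : k.-tuple 'I_n) a :
  seq_sign (vals (permute_tuple s t) ++ a) = (-1) ^+ s * seq_sign (vals t ++ a).
Proof. by rewrite !seq_sign_cat seq_sign_permute (perm_big _ (perm_vals s t)) !mulrA. Qed.

Lemma seq_sign_catr k n (s : 'S_k) a (t : k.-tuple 'I_n) :
  seq_sign (a ++ vals (permute_tuple s t)) = (-1) ^+ s * seq_sign (a ++ vals t).
Proof.
rewrite !seq_sign_cat seq_sign_permute.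
under eq_bigr do rewrite (perm_big _ (perm_vals s t)).
by rewrite mulrCA.
Qed.

Lemma vol0_cat (t : 3.-tuple 'I_8) (u : 5.-tuple 'I_8) :
  vol0 R [tuple of t ++ u] = (seq_sign (vals t ++ vals u))%:~R.
Proof. by rewrite vol0E; congr ((seq_sign _)%:~R); exact: map_cat. Qed.

Lemma hodge_terms_eval (T : ctensor R 8 3) (t : 3.-tuple 'I_8) (u : 5.-tuple 'I_8) :
  lin_eval T (hodge_terms (vals t) (vals u)) =
  vol0 R [tuple of t ++ u] * torsion5 (@g0 R) (@Phi0 R) T u.
Proof.
rewrite vol0_cat.
case/tupleP: u => a u; case/tupleP: u => i u; case/tupleP: u => j u.
case/tupleP: u => k u; case/tupleP: u => l u; rewrite (tuple0 u) => {u}.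
rewrite lin_eval_nonzero /lin_eval big_map sum_iota.
rewrite /torsion5 !(tnth_nth a) /= !inordK //=.
rewrite /torsion_contr mulr_sumr; apply: eq_bigr => p _.
rewrite (bigD1 p) //= inv_metric_g0 (eqxx p) mulr1 big1 ?addr0; last first.
  by move=> q /negPf neq_qp; rewrite inv_metric_g0 neq_qp mulr0 mul0r.
rewrite intrM -mulrA; congr (_ * _).
by rewrite Phi0E mulrC -(at_seq_vals T).
Qed.

Lemma hodge_lin_eval (T : ctensor R 8 3) (t : 3.-tuple 'I_8) :
  lin_eval T (hodge_lin (vals t)) =
  \sum_(u : 5.-tuple 'I_8) vol0 R [tuple of t ++ u] * torsion5 (@g0 R) (@Phi0 R) T u.
Proof.
rewrite [hodge_lin _]/(flatten _) lin_eval_flatten big_map sum_arrangements; last first.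
  move=> u not_uniq; rewrite lin_eval_nonzero /lin_eval big_map big1 // => p _ /=.
  rewrite seq_sign_not_uniq ?mul0r //; apply: contraL not_uniq.
  by rewrite cat_uniq negb_or negbK => /and3P[_ -> ->].
by rewrite sum_words; apply: eq_bigr => u _; exact: hodge_terms_eval.
Qed.

Lemma hodge_lin_range (t : 3.-tuple 'I_8) :
  all (fun x => in_range x.2) (hodge_lin (vals t)).
Proof.
have arr_lt8 k s u : u \in arrangements k s -> (size u == k) && all (ltn^~ 8) u.
  elim: k s u => [|k IH] s u; first by rewrite inE => /eqP ->.
  case/flatten_mapP => a; rewrite mem_filter mem_iota => /andP[_ /andP[_ a8]].
  by case/mapP => v /IH /andP[/eqP <- v8] -> /=; rewrite eqxx v8 andbT.
apply/allP => x /flatten_mapP[u /arr_lt8 /andP[/eqP size_u u8]].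
rewrite mem_filter => /andP[_ /mapP[p]]; rewrite mem_iota => /andP[_ p8] ->.
rewrite /in_range /=; apply/and4P; split=> //.
- by apply: (allP u8 (nth 0%N u 0)); rewrite mem_nth // size_u.
- by apply: (allP u8 (nth 0%N u 1)); rewrite mem_nth // size_u.
Qed.

Lemma hodge5_g0 (T : ctensor R 8 3) : is_alternating T ->
  hodge5 (@g0 R) (@vol0 R) (fun u => 20%:R * antisym (torsion5 (@g0 R) (@Phi0 R) T) u)
  = fun t => 2%:R * J3 (@g0 R) (@Phi0 R) T t.
Proof.
move=> alt_T; pose f (t : 3.-tuple 'I_8) (u : 5.-tuple 'I_8) := vol0 R [tuple of t ++ u].
have alt_f t : is_alternating (f t).
  move=> s u; rewrite /f !vol0_cat seq_sign_catr intrM.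
  by congr (_ * _); case: (odd_perm s); rewrite ?expr0 ?expr1 ?rmorphN.
have hodgeE t : hodge5 (@g0 R) (@vol0 R)
    (fun u => 20%:R * antisym (torsion5 (@g0 R) (@Phi0 R) T) u) t =
    6%:R^-1 * lin_eval T (hodge_lin (vals t)).
  rewrite /hodge5 raise_g0 hodge_lin_eval.
  under eq_bigr do rewrite mulrCA.
  (* The volume form alternates in its last five slots, so the antisymmetrisation drops out under
     the sum, and 20 / 5! = 1/6 remains. *)
  rewrite -mulr_sumr mulrA (sum_alt_antisym _ (alt_f t)); congr (_ * _).
  by rewrite (_ : 5`! = 120)%N //; field.
apply: alt_sorted.
- move=> s t; rewrite !hodgeE !hodge_lin_eval mulrCA; congr (_ * _).
  rewrite mulr_sumr; apply: eq_bigr => u _; rewrite mulrA; congr (_ * _).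
  rewrite !vol0_cat seq_sign_catl intrM.
  by congr (_ * _); case: (odd_perm s); rewrite ?expr0 ?expr1 ?rmorphN.
- by move=> s t; rewrite J3_alt mulrCA.
move=> t srt; rewrite hodgeE J3_lin_eval.
have := lin_zeroP alt_T _ (hodge_lin_zero (mem_triples srt)).
rewrite all_cat lin_scale_range J3_lin_range ?in_range_vals // andbT.
rewrite hodge_lin_range => /(_ isT).
rewrite lin_eval_cat lin_eval_scale.
rewrite (_ : (-6)%:~R = - 6%:R :> R) ?rmorphN // mulNr => /subr0_eq ->.
by rewrite mulKf // pnatr_eq0.
Qed.

End Standard.

(** * Smooth functions on open sets *)

Section SmoothFunctions.
Variables (R : realType) (n : nat) (U : set 'rV[R]_n).
Hypothesis openU : open U.
Implicit Types f g : 'rV[R]_n -> R.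

Lemma near_eq_on f g x : (forall y, U y -> f y = g y) -> U x -> {near x, f =1 g}.
Proof.
by move=> fg Ux; apply: filterS (open_nbhs_nbhs (conj openU Ux)) => y /fg.
Qed.

Lemma eq_partial f g x a :
  (forall y, U y -> f y = g y) -> U x -> partial a f x = partial a g x.
Proof. by move=> fg Ux; apply: near_eq_derive; exact: near_eq_on fg Ux. Qed.

(** Since [U] is open, agreement on [U] is agreement near each of its points, so derivatives agree
    as well. This lets the closure proofs below replace [partial] by a differentiation formula that
    is known only on [U]. *)
Lemma eq_Ck k f g : (forall y, U y -> f y = g y) -> Ck k U f -> Ck k U g.
Proof.
have eq_cont (h h' : 'rV[R]_n -> R) : (forall y, U y -> h y = h' y) ->
    (forall x, U x -> {for x, continuous h}) -> forall x, U x -> {for x, continuous h'}.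
  move=> hh' ch x Ux; rewrite /prop_for /continuous_at -hh' //.
  by apply: cvg_trans (ch x Ux); apply: (near_eq_cvg (near_eq_on hh' Ux)).
elim: k f g => [|k IH] f g fg [cf df].
  by split=> //; exact: eq_cont cf.
split; first exact: eq_cont cf.
move=> a; have [dfa Cfa] := df a; split.
  by move=> x Ux; apply: near_eq_derivable (dfa x Ux); exact: near_eq_on.
by apply: IH Cfa => y Uy; apply: eq_partial.
Qed.

Lemma CkW k f : Ck k.+1 U f -> Ck k U f.
Proof.
elim: k f => [|k IH] f [cf df]; split => //.
by move=> a; have [dfa Cfa] := df a; split => //; apply: IH.
Qed.

Lemma Ck_cst k c : Ck k U (fun=> c).
Proof.
elim: k c => [|k IH] c; split => //; try by move=> x _; exact: cst_continuous.
move=> a; split; first by move=> x _; exact: derivable_cst.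
by apply: eq_Ck (IH 0) => y _; rewrite /partial derive_cst.
Qed.

Lemma Ck_add k f g : Ck k U f -> Ck k U g -> Ck k U (fun x => f x + g x).
Proof.
elim: k f g => [|k IH] f g [cf df] [cg dg]; split => //.
- by move=> x Ux; apply: continuousD; [exact: cf|exact: cg].
- by move=> x Ux; apply: continuousD; [exact: cf|exact: cg].
move=> a; have [dfa Cfa] := df a; have [dga Cga] := dg a; split.
  by move=> x Ux; apply: derivableD; [exact: dfa|exact: dga].
apply: eq_Ck (IH _ _ Cfa Cga) => x Ux.
by rewrite /partial deriveD //; [exact: dfa|exact: dga].
Qed.

(** The Leibniz rule involves [f] and [g] themselves next to their derivatives, hence the use of
    [CkW]. *)
Lemma Ck_mul k f g : Ck k U f -> Ck k U g -> Ck k U (fun x => f x * g x).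
Proof.
elim: k f g => [|k IH] f g Cf Cg.
  case: Cf Cg => cf _ [cg _]; split => // x Ux.
  by apply: continuousM; [exact: cf|exact: cg].
have := (CkW Cf, CkW Cg) => -[Cf' Cg'].
case: Cf Cg => cf df [cg dg]; split.
  by move=> x Ux; apply: continuousM; [exact: cf|exact: cg].
move=> a; have [dfa Cfa] := df a; have [dga Cga] := dg a; split.
  by move=> x Ux; apply: derivableM; [exact: dfa|exact: dga].
apply: eq_Ck (Ck_add (IH _ _ Cf' Cga) (IH _ _ Cg' Cfa)) => x Ux.
by rewrite /partial deriveM //; [exact: dfa|exact: dga].
Qed.

Lemma Ck_inv k f : (forall x, U x -> f x != 0) ->
  Ck k U f -> Ck k U (fun x => (f x)^-1).
Proof.
move=> f_neq0; elim: k => [|k IH] Cf.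
  by case: Cf => cf _; split => // x Ux; apply: continuousV; [exact: f_neq0|exact: cf].
have Cf' := IH (CkW Cf).
case: Cf => cf df; split.
  by move=> x Ux; apply: continuousV; [exact: f_neq0|exact: cf].
move=> a; have [dfa Cfa] := df a; split.
  by move=> x Ux; apply: derivableV; [exact: f_neq0|exact: dfa].
apply: eq_Ck (Ck_mul (Ck_mul (Ck_cst k (-1)) (Ck_mul Cf' Cf')) Cfa) => x Ux.
rewrite /partial deriveV ?f_neq0 //; last exact: dfa.
by rewrite mulN1r -expr2 exprVn.
Qed.

Lemma smooth_cst c : smooth U (fun=> c).
Proof. by move=> k; exact: Ck_cst. Qed.

Lemma smoothD f g : smooth U f -> smooth U g -> smooth U (fun x => f x + g x).
Proof. by move=> sf sg k; apply: Ck_add. Qed.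

Lemma smoothM f g : smooth U f -> smooth U g -> smooth U (fun x => f x * g x).
Proof. by move=> sf sg k; apply: Ck_mul. Qed.

Lemma smoothV f : (forall x, U x -> f x != 0) -> smooth U f ->
  smooth U (fun x => (f x)^-1).
Proof. by move=> f0 sf k; apply: Ck_inv. Qed.

Lemma eq_smooth f g : (forall y, U y -> f y = g y) -> smooth U f -> smooth U g.
Proof. by move=> fg sf k; apply: eq_Ck (sf k). Qed.

Lemma smooth_sum (I : Type) (r : seq I) (P : pred I) (F : I -> 'rV[R]_n -> R) :
  (forall i, smooth U (F i)) -> smooth U (fun x => \sum_(i <- r | P i) F i x).
Proof.
move=> sF; elim: r => [|i r IH].
  by apply: eq_smooth (smooth_cst 0) => x _; rewrite big_nil.
apply: (@eq_smooth (fun x => (if P i then F i x else 0) + \sum_(j <- r | P j) F j x)).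
  by move=> x _; rewrite big_cons; case: (P i); rewrite ?add0r.
by apply: smoothD => //; case: (P i) => //; exact: smooth_cst.
Qed.

Lemma smooth_prod (I : Type) (r : seq I) (P : pred I) (F : I -> 'rV[R]_n -> R) :
  (forall i, smooth U (F i)) -> smooth U (fun x => \prod_(i <- r | P i) F i x).
Proof.
move=> sF; elim: r => [|i r IH].
  by apply: eq_smooth (smooth_cst 1) => x _; rewrite big_nil.
apply: (@eq_smooth (fun x => (if P i then F i x else 1) * \prod_(j <- r | P j) F j x)).
  by move=> x _; rewrite big_cons; case: (P i); rewrite ?mul1r.
by apply: smoothM => //; case: (P i) => //; exact: smooth_cst.
Qed.

Lemma smooth_det m (A : 'rV[R]_n -> 'M[R]_m) :
  (forall i j, smooth U (fun x => A x i j)) -> smooth U (fun x => \det (A x)).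
Proof.
move=> sA; apply: smooth_sum => s; apply: smoothM; first exact: smooth_cst.
exact: smooth_prod.
Qed.

(** Cramer's rule: an entry of the inverse is a cofactor divided by the determinant. *)
Lemma smooth_invmx m (A : 'rV[R]_n -> 'M[R]_m) i j :
  (forall i j, smooth U (fun x => A x i j)) ->
  (forall x, U x -> A x \in unitmx) -> smooth U (fun x => invmx (A x) i j).
Proof.
move=> sA uA.
apply: (@eq_smooth (fun x => (\det (A x))^-1 *
  ((-1) ^+ (j + i) * \det (row' j (col' i (A x)))))).
  by move=> x Ux; rewrite /invmx uA // !mxE.
apply: smoothM; last apply: smoothM.
- apply: smoothV; last exact: smooth_det.
  by move=> x /uA; rewrite unitmxE unitfE.
- exact: smooth_cst.
apply: smooth_det => k l.
by apply: eq_smooth (sA (lift j k) (lift i l)) => x _; rewrite !mxE.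
Qed.

End SmoothFunctions.

(** * The torsion of a Cayley form *)

Section ExteriorDerivative.
Variables (R : realType) (n : nat) (M : smoothManifold R n).

(* For a symmetric connection the Christoffel terms cancel on
   antisymmetrisation, so partial derivatives can be replaced by covariant
   ones in [d]. *)
Lemma ext_d_nabla (Gam : connection_coef M) k (w : comp_field M k) c x :
  (forall p i j, Gam c x p i j = Gam c x p j i) ->
  ext_d w c x = fun t => k.+1%:R * antisym (fun u : k.+1.-tuple 'I_n =>
    nabla Gam w c x (thead u) [tuple of behead u]) t.
Proof.
move=> sym_Gam; apply/funext => t; rewrite /ext_d; congr (_ * _).
pose h m (u : k.+1.-tuple 'I_n) :=
  \sum_p Gam c x p (thead u) (tnth [tuple of behead u] m) *
  w c x (subst_tuple [tuple of behead u] m p).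
have -> : (fun u : k.+1.-tuple 'I_n =>
    partial (thead u) (fun y => w c y [tuple of behead u]) x) =
  (fun u : k.+1.-tuple 'I_n =>
    nabla Gam w c x (thead u) [tuple of behead u] + \sum_m h m u).
  by apply/funext => u; rewrite /nabla subrK.
rewrite antisymD antisym_sum big1 ?addr0 // => m _.
(* Exchanging the derivative slot with slot [m] swaps the two lower indices of [Gam] and leaves the
   other factor alone, since slot [m] is overwritten by [p]. *)
apply: (@antisym_tperm_inv _ _ _ _ ord0 (lift ord0 m)); first exact: neq_lift.
have tnth_tail (u : k.+1.-tuple 'I_n) l :
    tnth [tuple of behead u] l = tnth u (lift ord0 l).
  by rewrite tnth_behead; congr tnth; apply: val_inj; rewrite /= inordK // ltnS.
move=> u; apply: eq_bigr => p _.
have -> : thead (permute_tuple (tperm ord0 (lift ord0 m)) u) = tnth [tuple of behead u] m.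
  by rewrite /thead tnth_mktuple tpermL tnth_tail.
rewrite (tnth_tail (permute_tuple _ _)) tnth_mktuple tpermR sym_Gam; congr (_ * w c x _).
apply: eq_from_tnth => l; rewrite !tnth_mktuple; case: eqP => // /eqP neq_lm.
rewrite !tnth_tail tnth_mktuple tpermD // ?neq_lift //.
by rewrite (inj_eq lift_inj) eq_sym.
Qed.

End ExteriorDerivative.

(** * Transport of the Euclidean identities to an arbitrary frame *)

Section Pointwise.
Variable R : realType.
Implicit Types (A : 'M[R]_8) (gam T : ctensor R 8 3).

Lemma metric_pullback_g0 A :
  metric_mx (pullback A (@g0 R)) = A^T *m A.
Proof. by rewrite metric_pullback metric_g0 mulmx1. Qed.

Lemma unitmx_g0 : metric_mx (@g0 R) \in unitmx.
Proof. by rewrite metric_g0 unitmx1. Qed.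

(** Presents an arbitrary tensor as a pullback along the frame, so that equivariance applies to
    it. *)
Lemma pullback_inv k A (w : ctensor R 8 k) : A \in unitmx ->
  pullback A (pullback (invmx A) w) = w.
Proof. by move=> uA; rewrite pullbackM mulVmx // pullback1. Qed.

Lemma J3_quadratic_pullback A gam : A \in unitmx -> is_alternating gam ->
  let J := J3 (pullback A (@g0 R)) (pullback A (@Phi0 R)) in
  J (J gam) = fun t => 6%:R * gam t - 5%:R * J gam t.
Proof.
move=> uA alt_gam /=; rewrite -(pullback_inv gam uA).
rewrite !J3_pullback ?unitmx_g0 // J3_quadratic; last exact: pullback_alt.
move: (pullback (invmx A) gam) => w'; move: (J3 _ _ w') => w.
apply/funext => t; rewrite !pullbackE !mulr_sumr -sumrB.
by apply: eq_bigr => s _; rewrite mulrBr mulrCA [X in _ - X]mulrCA.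
Qed.

Lemma hodge5_pullback_g0 A T : A \in unitmx -> is_alternating T ->
  let g := pullback A (@g0 R) in let Phi := pullback A (@Phi0 R) in
  hodge5 g (pullback A (@vol0 R)) (fun u => 20%:R * antisym (torsion5 g Phi T) u) =
  fun t => 2%:R * J3 g Phi T t.
Proof.
move=> uA alt_T g Phi; rewrite -(pullback_inv T uA) /g /Phi.
rewrite J3_pullback ?unitmx_g0 // torsion5_pullback ?unitmx_g0 //; last 2 first.
- by rewrite metric_g0 trmx1.
- exact: Phi0_alt.
rewrite -pullback_antisym -pullbackZ hodge5_pullback ?unitmx_g0 //.
by rewrite hodge5_g0 ?pullbackZ //; exact: pullback_alt.
Qed.

Lemma J3_linear g Phi gam gam' a b :
  J3 g Phi (fun t => a * gam t + b * gam' t) =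
  fun t => a * J3 g Phi gam t + b * J3 g Phi gam' t :> R.
Proof.
have contrD : contr3 g Phi (fun t => a * gam t + b * gam' t) =
    fun u => a * contr3 g Phi gam u + b * contr3 g Phi gam' u.
  apply/funext => u; rewrite /contr3 /Phi_contr !mulr_sumr -big_split.
  apply: eq_bigr => p _; rewrite !mulr_sumr -big_split; apply: eq_bigr => q _.
  by rewrite /= mulrDr; congr (_ + _); exact: mulrCA.
apply/funext => t; rewrite !J3E contrD antisymD !antisymZ mulrDr.
by congr (_ + _); exact: mulrCA.
Qed.

End Pointwise.

(** * Tensor fields on the manifold and the inverse of [J3] *)

Section Fields.
Variables (R : realType) (M : smoothManifold R 8).
Variables (Phi : comp_field M 4) (g : comp_field M 2) (eps : comp_field M 8).
Hypotheses (hPhi : cayley_form Phi) (hg : determined_by Phi g eps).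

Lemma cayley_frame c x : chart_im c x -> exists2 A : 'M[R]_8, A \in unitmx &
  [/\ Phi c x = pullback A (@Phi0 R), g c x = pullback A (@g0 R)
    & eps c x = pullback A (@vol0 R)].
Proof. by case: hg => _ h /h [A [uA ? ? ?]]; exists A. Qed.

Lemma cayley_metric_unit c x : chart_im c x -> metric_mx (g c x) \in unitmx.
Proof.
move=> /cayley_frame[A uA [_ -> _]].
by rewrite metric_pullback_g0 unitmx_mul unitmx_tr uA.
Qed.

Lemma J3_quadratic_field c x gam : chart_im c x -> is_alternating gam ->
  J3 (g c x) (Phi c x) (J3 (g c x) (Phi c x) gam) =
  fun t => 6%:R * gam t - 5%:R * J3 (g c x) (Phi c x) gam t.
Proof.
by move=> /cayley_frame[A uA [-> -> _]]; exact: J3_quadratic_pullback.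
Qed.

(** The quadratic relation expresses [6 gam] through [J3 gam] and its image under [J3]. *)
Lemma J3_inj c x gam gam' : chart_im c x ->
  is_alternating gam -> is_alternating gam' ->
  J3 (g c x) (Phi c x) gam = J3 (g c x) (Phi c x) gam' -> gam = gam'.
Proof.
move=> Ux alt_gam alt_gam' eqJ.
have := J3_quadratic_field Ux alt_gam; rewrite eqJ J3_quadratic_field // => e.
apply/funext => t; have := congr1 (fun f => f t) e => /= /addIr.
by move=> /mulfI ->; rewrite ?pnatr_eq0.
Qed.

(* [J3^2 = 6 - 5 J3] gives the inverse [(J3 + 5) / 6]. *)
Definition J3_inv_field (eta : comp_field M 3) : comp_field M 3 := fun c x t =>
  6%:R^-1 * J3_field g Phi eta c x t + (5%:R / 6%:R) * eta c x t.

Lemma J3_inv_alt c x eta : is_alternating (eta c x) ->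
  is_alternating (J3_inv_field eta c x).
Proof.
move=> alt_eta s t; rewrite /J3_inv_field /J3_field J3_alt alt_eta mulrDr.
by congr (_ + _); exact: mulrCA.
Qed.

Lemma J3_invK c x eta : chart_im c x -> is_alternating (eta c x) ->
  J3_field g Phi (J3_inv_field eta) c x = eta c x.
Proof.
move=> Ux alt_eta; rewrite /J3_field /J3_inv_field.
rewrite (@J3_linear _ _ _ (J3 (g c x) (Phi c x) (eta c x)) (eta c x)).
rewrite J3_quadratic_field //; apply/funext => t.
move: (J3 _ _ _ _) (eta c x t) => y z; by field.
Qed.

Lemma transition_im (c c' : chart M) x : overlap c c' x ->
  chart_im c x /\ chart_im c' (transition c c' x).
Proof.
case=> p [dp dp'] <-; split; first by exists p.
by rewrite /transition coordsK //; exists p.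
Qed.

Lemma J3_field_form gam : diff_form gam -> diff_form (J3_field g Phi gam).
Proof.
move=> [[smooth_gam law_gam] alt_gam].
have [[[smooth_Phi law_Phi] _] _] := hPhi.
have [[[smooth_g law_g] _] _] := hg.
split; last by move=> c x _; exact: J3_alt.
split=> [c t|c c' x ov].
  have openU := @chart_im_open _ _ _ c.
  have smooth_ginv i j : smooth (chart_im c) (fun x => inv_metric (g c x) i j).
    apply: smooth_invmx => // [k l|x]; last exact: cayley_metric_unit.
    by apply: eq_smooth (smooth_g c [tuple k; l]) => // x _; rewrite mxE.
  apply: smoothM => //; first exact: smooth_cst.
  apply: smoothM => //; first exact: smooth_cst.
  apply: smooth_sum => // s; apply: smoothM => //; first exact: smooth_cst.
  apply: smooth_sum => // p; apply: smooth_sum => // q.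
  apply: smoothM => //; apply: smooth_sum => // r; apply: smooth_sum => // r'.
  by apply: smoothM => //; apply: smoothM.
have [Ux Ux'] := transition_im ov.
(* The metric at [x] is the pullback along this Jacobian and is nondegenerate, which forces the
   Jacobian to be invertible without differentiating the inverse transition. *)
have uJ : jacobian_mx (transition c c') x \in unitmx.
  have := cayley_metric_unit Ux; rewrite (law_g _ _ _ ov) metric_pullback.
  by rewrite !unitmx_mul => /andP[_].
rewrite /J3_field (law_g _ _ _ ov) (law_Phi _ _ _ ov) (law_gam _ _ _ ov).
by rewrite J3_pullback //; exact: cayley_metric_unit.
Qed.

Lemma J3_inv_form eta : diff_form eta -> diff_form (J3_inv_field eta).
Proof.
move=> form_eta; have [[smooth_J law_J] _] := J3_field_form form_eta.
have [[smooth_eta law_eta] alt_eta] := form_eta.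
split; last first.
  by move=> c x Ux; apply: J3_inv_alt; exact: alt_eta.
split=> [c t|c c' x ov].
  have openU := @chart_im_open _ _ _ c.
  apply: smoothD => //; apply: smoothM => //; exact: smooth_cst.
apply/funext => t; rewrite /J3_inv_field (law_J _ _ _ ov) (law_eta _ _ _ ov).
rewrite !pullbackE !mulr_sumr -big_split; apply: eq_bigr => s _.
by rewrite /= mulrDr; congr (_ + _); exact: mulrCA.
Qed.

(** Here 20 is 5, from the exterior derivative of a 4-form, times 4, from the torsion equation;
    [antisym_tail] merges the two antisymmetrisations. *)
Lemma ext_d_torsion (Gam : connection_coef M) (T : comp_field M 3) c x :
  levi_civita g Gam -> torsion_form g Gam Phi T -> chart_im c x ->
  ext_d Phi c x = fun u => 20%:R * antisym (torsion5 (g c x) (Phi c x) (T c x)) u.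
Proof.
move=> hGam [_ hT] Ux; have [sym_Gam _] := hGam c x Ux.
rewrite (ext_d_nabla _ sym_Gam).
pose h i (u : 4.-tuple 'I_8) := torsion_contr (g c x) (Phi c x) (T c x) i
  (tnth u (inord 0)) (tnth u (inord 1)) (tnth u (inord 2)) (tnth u (inord 3)).
have -> : (fun u : 5.-tuple 'I_8 => nabla Gam Phi c x (thead u) [tuple of behead u]) =
    fun u : 5.-tuple 'I_8 => 4%:R * antisym (h (thead u)) [tuple of behead u].
  by apply/funext => u; exact: hT.
rewrite antisymZ antisym_tail; apply/funext => u; rewrite mulrA -natrM.
congr (_ * antisym _ _); apply/funext => v; rewrite /h /torsion5 !tnth_behead.
rewrite !inordK // /thead; congr torsion_contr; congr tnth.
by apply: val_inj; rewrite /= inordK.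
Qed.

Lemma hodge5_d_Phi (Gam : connection_coef M) (T : comp_field M 3) :
  levi_civita g Gam -> torsion_form g Gam Phi T ->
  eq_field (hodge5_field g eps (ext_d Phi)) (fun c x t => 2%:R * J3_field g Phi T c x t).
Proof.
move=> hGam hT c x Ux; rewrite /hodge5_field (ext_d_torsion hGam hT Ux) /J3_field.
have [[_ alt_T] _] := hT; have {}alt_T := alt_T c x Ux.
by have [A uA [-> -> ->]] := cayley_frame Ux; exact: hodge5_pullback_g0.
Qed.

End Fields.

Theorem proposition1p2 (R : realType) (M : smoothManifold R 8)
    (Phi : comp_field M 4) (g : comp_field M 2) (eps : comp_field M 8)
    (Gam : connection_coef M) (T : comp_field M 3)
    (hPhi : cayley_form Phi)
    (hg : determined_by Phi g eps)
    (hGam : levi_civita g Gam)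
    (hT : torsion_form g Gam Phi T) :
  [/\ eq_field (hodge5_field g eps (ext_d Phi))
               (fun c x t => 2%:R * J3_field g Phi T c x t),
      (forall c x, chart_im c x -> forall gam, is_alternating gam ->
         forall i j k : 'I_8,
           J3 (g c x) (Phi c x) gam [tuple i; j; k] =
           2%:R^-1 * (Phi_contr (g c x) (Phi c x) gam i j k
                      + Phi_contr (g c x) (Phi c x) gam j k i
                      + Phi_contr (g c x) (Phi c x) gam k i j)),
      (forall c x, chart_im c x ->
         set_bij (@alt_tensors R 8 3) (@alt_tensors R 8 3)
                 (J3 (g c x) (Phi c x))),
      (forall gam, diff_form gam -> diff_form (J3_field g Phi gam)) /\
      (forall eta, diff_form eta -> exists gam,
         [/\ diff_form gam, eq_field (J3_field g Phi gam) eta &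
             forall gam', diff_form gam' ->
               eq_field (J3_field g Phi gam') eta -> eq_field gam' gam])
    & forall gam, diff_form gam ->
        eq_field (hodge5_field g eps (ext_d Phi))
                 (fun c x t => 2%:R * J3_field g Phi gam c x t) ->
        eq_field gam T].
Proof.
have star_d := hodge5_d_Phi hg hGam hT.
split=> //.
- move=> c x Ux gam _ i j k; apply: J3_cyclic.
  by have [[_ alt_Phi] _] := hPhi; exact: alt_Phi.
- move=> c x Ux; split.
  + by move=> gam _; exact: J3_alt.
  + by move=> gam gam' /set_mem alt_gam /set_mem alt_gam'; exact: (J3_inj hg Ux).
  (* The inverse is defined on fields. The field equal to [eta] everywhere is in general no tensor
     field, but [J3_invK] is a pointwise statement. *)
  + move=> eta alt_eta; pose eta_field : comp_field M 3 := fun _ _ => eta.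
    exists (J3_inv_field Phi g eta_field c x).
      exact: J3_inv_alt.
    exact: (@J3_invK _ _ _ _ _ hg c x eta_field Ux alt_eta).
- split=> [gam|eta form_eta]; first exact: J3_field_form hPhi hg _.
  exists (J3_inv_field Phi g eta); split.
  + exact: J3_inv_form hPhi hg _ form_eta.
  + by move=> c x Ux; apply: (J3_invK hg Ux); exact: form_eta.2.
  + move=> gam' form_gam' eq_eta c x Ux.
    apply: (J3_inj hg Ux); first exact: form_gam'.2.
      exact: (J3_inv_form hPhi hg form_eta).2.
    have := J3_invK hg Ux (form_eta.2 c x Ux); rewrite /J3_field => ->.
    exact: eq_eta.
- move=> gam form_gam eq_gam c x Ux.
  apply: (J3_inj hg Ux); first exact: form_gam.2.
    exact: hT.1.2.
  apply/funext => t; have := congr1 (fun f => f t) (eq_gam c x Ux).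
  by rewrite star_d // => /mulfI inj2; symmetry; apply: inj2; rewrite pnatr_eq0.
Qed.
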